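(* Let $f:(0,\infty)\to\mathbb{R}$ be an operator monotone function such that $f(1)=0$, and let $\mu$ be a Borel probability measure on $\mathbb{P}$ with $$\int_{\mathbb{P}}\|f(y)\|\,d\mu(y)<\infty.$$ Then, for any $x\in\mathbb{P}$ and $\varepsilon>0$, the family of functions of $y\in\mathbb{P}$ $$\mathcal{F}_{x,\varepsilon}=\left\{\,y\mapsto\|f(z^{-1/2}yz^{-1/2})\| \colon z\in\mathbb{P},\ d_\infty(x,z)<\varepsilon\right\}$$ admits a common $L^1(\mu)$-dominating function, i.e. there is $g\in L^1(\mu)$ with $h\le g$ for every $h\in\mathcal{F}_{x,\varepsilon}$.
   Context: $\mathbb{P}$ is the cone of positive definite invertible bounded operators on a Hilbert space $\mathcal{H}$, with operator norm $\|\cdot\|$ and Thompson metric $d_\infty(a,b)=\|\log(a^{-1/2}ba^{-1/2})\|$. Borel probability measures on $\mathbb{P}$ are assumed fully supported, i.e. $\mu(\operatorname{supp}\mu)=1$ (the support is then separable). *)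

(* Defs.v *)
From HB Require Import structures.
From mathcomp Require Import all_boot all_order all_algebra sesquilinear.
From mathcomp Require Import complex.
From mathcomp Require Import all_classical all_reals all_analysis.

Set Implicit Arguments.
Unset Strict Implicit.
Unset Printing Implicit Defensive.

Import Order.TTheory GRing.Theory Num.Theory.
Import numFieldNormedType.Exports.

Local Open Scope classical_set_scope.
Local Open Scope complex_scope.
Local Open Scope ring_scope.

(* Complex Hilbert spaces. The norm of [H] takes its values in [R[i]] and the
   form is linear in its first argument and conjugate-linear in the second. *)
HB.mixin Record CompleteNormedModule_isHilbert (R : realType) H
    & CompleteNormedModule R[i] H := {
  inner : {dot H for @Num.conj R[i]} ;
  inner_norm : forall x : H, inner x x = `|x| ^+ 2
}.

#[short(type="hilbertType")]
HB.structure Definition Hilbert (R : realType) :=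
  {H of CompleteNormedModule R[i] H & CompleteNormedModule_isHilbert R H}.

Section Operators.
Variables (R : realType) (H : hilbertType R).
Implicit Types (a b : H -> H) (f : R -> R).

Definition bounded_op a :=
  linear a /\ exists M : R[i], forall x, `|a x| <= M * `|x|.

Definition opnorm a : R :=
  sup [set complex.Re `|a x| | x in [set x : H | `|x| <= 1]].

Definition invertible_op a :=
  exists b, [/\ bounded_op b, cancel a b & cancel b a].

Definition spectrum a : set R[i] :=
  [set l | ~ invertible_op (fun x => a x - l *: x)].

(* The order on [R[i]] only compares numbers with the same imaginary part, so
   these inequalities also say that [inner (a x) x], resp. the difference of
   the two sides, is real. *)
Definition posdef_op a := forall x : H, x != 0 -> 0 < inner (a x) x.

Definition loewner_le a b := forall x : H, inner (a x) x <= inner (b x) x.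

Definition op_horner (p : {poly R}) a : H -> H :=
  fun x => \sum_(k < size p) (p`_k)%:C *: iter k a x.

(* [b = f(a)] in the continuous functional calculus of the bounded self-adjoint
   operator [a]: polynomials converging to [f] uniformly on the (real) spectrum
   of [a] converge to [b] in operator norm when evaluated at [a]. *)
Definition is_fcalc f a b :=
  bounded_op b /\
  forall e : R, 0 < e -> exists p : {poly R},
    (forall t : R, spectrum a t%:C -> `|f t - p.[t]| <= e) /\
    opnorm (fun x => b x - op_horner p a x) <= e.

Definition fcalc f a : H -> H := xget (fun=> 0) [set b | is_fcalc f a b].

Definition pd_cone : set (H -> H) :=
  [set a | [/\ bounded_op a, posdef_op a & invertible_op a]].

Record pdop : Type := PdOp { pdop_val :> H -> H ; pdopP : pd_cone pdop_val }.

Lemma pd_cone_id : pd_cone (id : H -> H).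
Proof.
have b1 : bounded_op (id : H -> H).
  by split=> //; exists 1 => x; rewrite mul1r.
split=> //; last by exists id.
move=> x x0; exact: neq0_dnorm_gt0.
Qed.

HB.instance Definition _ := gen_eqMixin pdop.
HB.instance Definition _ := gen_choiceMixin pdop.
HB.instance Definition _ := isPointed.Build pdop (PdOp pd_cone_id).

End Operators.

Section Topology.
Variables (R : realType) (H : hilbertType R).

(* The operator norm topology; the Thompson metric induces the same one. *)
Definition pd_open : set (set (pdop H)) :=
  [set U : set (pdop H) | forall u : pdop H, U u -> exists2 e : R, 0 < e &
     forall v : pdop H, opnorm (fun x => v x - u x) < e -> U v].

Lemma pd_openT : pd_open setT.
Proof. by move=> u _; exists 1. Qed.

Lemma pd_openI : setI_closed pd_open.
Proof.
move=> U V oU oV u [/oU[d d0 dU] /oV[e e0 eV]].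
exists (Num.min d e); first by rewrite lt_min d0 e0.
by move=> v; rewrite lt_min => /andP[/dU Uv /eV Vv].
Qed.

Lemma pd_open_bigU (I : Type) (F : I -> set (pdop H)) :
  (forall i, pd_open (F i)) -> pd_open (\bigcup_i F i).
Proof.
move=> oF u [i _ /oF[e e0 eF]]; exists e => // v /eF Fv.
by exists i.
Qed.

HB.instance Definition _ :=
  isOpenTopological.Build (pdop H) pd_openT pd_openI pd_open_bigU.

End Topology.

Notation borel_pdop H := (g_sigma_algebraType (@open (pdop H))).

Section Thompson.
Variables (R : realType) (H : hilbertType R).

(* z^(-1/2) y z^(-1/2) *)
Definition invsqrt_congr (z y : H -> H) : H -> H :=
  let s := fcalc (fun t : R => t `^ (- 2^-1)) z in s \o y \o s.

Definition thompson (u v : pdop H) : R := opnorm (fcalc (@ln R) (invsqrt_congr u v)).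

Definition thompson_family (f : R -> R) (x : pdop H) (e : R) :
    set (pdop H -> R) :=
  [set (fun y : pdop H => opnorm (fcalc f (invsqrt_congr z y)))
     | z in [set z | thompson x z < e]].

Definition supp (mu : set (pdop H) -> \bar R) : set (pdop H) :=
  [set u | forall U : set (pdop H), open U -> U u -> (0 < mu U)%E].

End Thompson.

(* Operator monotonicity on (0, +oo), over all Hilbert spaces (equivalently,
   for matrices of all orders). Only the restriction of [f] to (0, +oo) matters,
   since elements of the cone have their spectrum there. *)
Definition operator_monotone (R : realType) (f : R -> R) :=
  forall (K : hilbertType R) (a b : pdop K),
    loewner_le a b -> loewner_le (fcalc f a) (fcalc f b).

(* Main.v *)
Require Import Defs.
From HB Require Import structures.
From mathcomp Require Import all_boot all_order all_algebra sesquilinear.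
From mathcomp Require Import complex ring lra.
From mathcomp Require Import all_classical all_reals all_analysis measurable_realfun.

Set Implicit Arguments.
Unset Strict Implicit.
Unset Printing Implicit Defensive.

Import Order.TTheory GRing.Theory Num.Theory.
Import numFieldNormedType.Exports.

Local Open Scope classical_set_scope.
Local Open Scope complex_scope.
Local Open Scope ring_scope.

(** Write a positive operator y as lying between its extreme spectral values
    m(y) <= y <= M(y). Operator monotone functions are increasing, so
    ||f(y)|| = max (|f(M(y))|, |f(m(y))|), and everything about ||f(.)|| is read
    off from these two numbers.

    A ball of the Thompson metric around x is bounded in the Loewner order: if
    ||log(x^(-1/2) z x^(-1/2))|| < e then exp(-e) x <= z <= exp(e) x, so there is
    a constant C > 1, the same for all z in the ball, such that
    m(y) / C <= z^(-1/2) y z^(-1/2) <= C M(y) ([thompson_between],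
    [invsqrt_congr_between]). Hence the norm to be dominated is at most the
    larger of f(C M(y)) and -f(m(y) / C).

    The point is then that f cannot grow too fast under dilation. Monotonicity
    on operators of a two-dimensional space already makes f concave, and, since
    inversion reverses the order, it makes -f(1/t) concave as well
    ([two_level_mono_concave], [two_level_flip]). A concave increasing g with
    g(1) = 0 satisfies g(C t) <= 2 C |g(t)| + g(2 C)
    ([mono_concave_growth]). Applied to f at M(y) and to -f(1/t) at 1/m(y), this
    bounds the whole family by the single function
    2 C ||f(y)|| + f(2 C) - f(1/(2 C)), which is integrable as soon as ||f(y)|| is
    measurable; that holds because M and m are Lipschitz for the operator norm
    and f is continuous.

    The functional calculus is characterized by polynomial approximation on the
    spectrum, so its properties all rest on the identity
    ||p(a)|| = max of |p| over the spectrum of a, for a symmetric operator a and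
    a real polynomial p ([opnorm_op_horner_attained]), and its existence on a
    form of the Weierstrass theorem ([lipschitz_approx]). *)

(** * Real inner product of a complex Hilbert space *)

Section RealInner.
Variables (R : realType) (H : hilbertType R).
Implicit Types (x y z : H) (r s : R) (a b c : H -> H).

Definition rnorm x : R := complex.Re `|x|.
Definition rinner x y : R := complex.Re (inner x y).

Lemma rnormE x : `|x| = (rnorm x)%:C.
Proof. by rewrite /rnorm RRe_real // normr_real. Qed.

Lemma rnorm_ge0 x : 0 <= rnorm x.
Proof. by rewrite -ler0c -rnormE. Qed.

Lemma rnorm_eq0 x : (rnorm x == 0) = (x == 0).
Proof. by rewrite -(inj_eq (@complexI R)) -rnormE normr_eq0. Qed.

Lemma rnorm0 : rnorm 0 = 0. Proof. by apply/eqP; rewrite rnorm_eq0. Qed.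

Lemma rnormD x y : rnorm (x + y) <= rnorm x + rnorm y.
Proof. by rewrite -lecR rmorphD /= -!rnormE ler_normD. Qed.

Lemma rnormZ (l : R[i]) x : rnorm (l *: x) = complex.Re `|l| * rnorm x.
Proof.
rewrite /rnorm normrZ rnormE; case: `|l| => u v /=.
by rewrite mulr0 subr0.
Qed.

Lemma rnormZr r x : rnorm (r%:C *: x) = `|r| * rnorm x.
Proof.
rewrite rnormZ normc_def /=.
by rewrite expr0n addr0 sqrtr_sqr.
Qed.

Lemma rnormN x : rnorm (- x) = rnorm x. Proof. by rewrite /rnorm normrN. Qed.

Lemma rnormB x y : rnorm (x - y) = rnorm (y - x). Proof. by rewrite /rnorm distrC. Qed.

Lemma rinnerDl x y z : rinner (x + y) z = rinner x z + rinner y z.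
Proof. by rewrite /rinner linearDl raddfD. Qed.

Lemma innerC x y : inner x y = (inner y x)^*%C.
Proof. by rewrite (@hermC _ _ _ _ (inner)) expr0 mul1r. Qed.

Lemma rinnerC x y : rinner x y = rinner y x.
Proof. by rewrite /rinner innerC; case: (inner y x). Qed.

Lemma rinnerNl x y : rinner (- x) y = - rinner x y.
Proof. by rewrite /rinner linearNl raddfN. Qed.

Lemma innerZl (k : R[i]) x y : inner (k *: x) y = k * inner x y.
Proof. exact: linearZl_LR. Qed.

Lemma rinnerZl r x y : rinner (r%:C *: x) y = r * rinner x y.
Proof. by rewrite /rinner innerZl; case: (inner x y) => u v /=; rewrite mul0r subr0. Qed.

Lemma rinner_il x y : rinner ('i%C *: x) y = - complex.Im (inner x y).
Proof. by rewrite /rinner innerZl mulrC ReiNIm. Qed.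

Lemma rinner_ii x y : rinner ('i%C *: x) ('i%C *: y) = rinner x y.
Proof.
rewrite rinner_il innerC innerZl innerC /rinner.
by case: (inner x y) => u v /=; rewrite !mul0r !mul1r add0r !opprK.
Qed.

Lemma rinnerDr x y z : rinner x (y + z) = rinner x y + rinner x z.
Proof. by rewrite !(rinnerC x) rinnerDl. Qed.
Lemma rinnerNr x y : rinner x (- y) = - rinner x y.
Proof. by rewrite !(rinnerC x) rinnerNl. Qed.
Lemma rinnerZr r x y : rinner x (r%:C *: y) = r * rinner x y.
Proof. by rewrite !(rinnerC x) rinnerZl. Qed.

Lemma rinnerxx x : rinner x x = rnorm x ^+ 2.
Proof. by rewrite /rinner inner_norm rnormE -rmorphXn. Qed.

(** Symmetry for the real inner product alone. For a complex-linear operator it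
    is equivalent to self-adjointness, because multiplication by i preserves
    the real inner product. *)
Definition symmetric_op a := forall x y, rinner (a x) y = rinner x (a y).

Lemma linear_op0 a : linear a -> a 0 = 0.
Proof. by move=> la; have := la (-1) 0 0; rewrite scaler0 addr0 scaleN1r addNr. Qed.
Lemma linear_opD a x y : linear a -> a (x + y) = a x + a y.
Proof. by move=> la; have := la 1 x y; rewrite !scale1r. Qed.
Lemma linear_opZ a l x : linear a -> a (l *: x) = l *: a x.
Proof. by move=> la; have := la l x 0; rewrite !addr0 (linear_op0 la) addr0. Qed.
Lemma linear_opN a x : linear a -> a (- x) = - a x.
Proof. by move=> la; rewrite -scaleN1r (linear_opZ _ _ la) scaleN1r. Qed.
Lemma linear_opB a x y : linear a -> a (x - y) = a x - a y.
Proof. by move=> la; rewrite (linear_opD _ _ la) (linear_opN _ la). Qed.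

(** Moving [a], then i, across the inner product changes the sign of the left-hand
    side, which is the imaginary part of the quadratic form. *)
Lemma symmetric_rinner_i a x : linear a -> symmetric_op a -> rinner (a x) ('i%C *: x) = 0.
Proof.
move=> la sa.
have : rinner (a x) ('i%C *: x) = - rinner (a x) ('i%C *: x).
  rewrite {1}sa (linear_opZ _ _ la) -rinner_ii scalerA -expr2 sqr_i scaleN1r rinnerNr.
  by rewrite rinnerC.
lra.
Qed.

Lemma symmetric_inner a x : linear a -> symmetric_op a -> inner (a x) x = (rinner (a x) x)%:C.
Proof.
move=> la sa; have := symmetric_rinner_i x la sa; rewrite rinnerC rinner_il innerC /rinner.
by case: (inner (a x) x) => u v /=; rewrite opprK => ->.
Qed.

(** The quadratic form of a positive operator is real, and polarization turns
    this into symmetry. *)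
Lemma posdef_symmetric a : linear a -> posdef_op a -> symmetric_op a.
Proof.
move=> la pa.
have im0 x : complex.Im (inner (a x) x) = 0.
  have [->|x0] := eqVneq x 0; first by rewrite (linear_op0 la) linear0r.
  by apply: ger0_Im; apply: ltW; exact: pa.
have imE x y : complex.Im (inner (a x) y) = - complex.Im (inner (a y) x).
  have := im0 (x + y); rewrite (linear_opD _ _ la) linearDl !linearDr /=.
  rewrite !raddfD /= (im0 x) (im0 y); lra.
move=> x y; have := imE ('i%C *: x) y.
rewrite (linear_opZ _ _ la) innerZl /= mulrC ImiRe -/(rinner _ _) => ->.
rewrite innerC innerZl /rinner.
by case: (inner x (a y)) => u v /=; rewrite mul0r mul1r add0r opprK.
Qed.

Lemma posdef_rinner_ge0 a x : linear a -> posdef_op a -> 0 <= rinner (a x) x.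
Proof.
move=> la pa; have [->|x0] := eqVneq x 0.
  by rewrite (linear_op0 la) rinnerxx exprn_ge0 ?rnorm_ge0.
by have := pa _ x0; rewrite ltcE => /andP[_ /ltW].
Qed.

(** Cauchy-Schwarz for the semi-definite form of [a], by completing the square. *)
Lemma cauchy_schwarz_op a x y : linear a -> symmetric_op a -> (forall z, 0 <= rinner (a z) z) ->
  rinner (a x) y ^+ 2 <= rinner (a x) x * rinner (a y) y.
Proof.
move=> la sa pa.
have P s t : 0 <= s ^+ 2 * rinner (a x) x - 2 * s * t * rinner (a x) y + t ^+ 2 * rinner (a y) y.
  have := pa (s%:C *: x - t%:C *: y).
  rewrite (linear_opB _ _ la) !(linear_opZ _ _ la) !(rinnerDl, rinnerDr, rinnerNl, rinnerNr,
    rinnerZl, rinnerZr).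
  rewrite (sa y) (rinnerC y); lra.
set A := rinner (a x) x; set B := rinner (a x) y; set C := rinner (a y) y.
have A0 : 0 <= A := pa x. have C0 : 0 <= C := pa y.
have [A1|] := ltP 0 A.
  by have := P B A; rewrite -/A -/B -/C => h; nra.
move=> A2; have {}A2 : A = 0 by lra.
have := P (C + 1) B; rewrite -/A -/B -/C A2 mulr0 add0r mul0r => h.
nra.
Qed.

Lemma cauchy_schwarz x y : rinner x y <= rnorm x * rnorm y.
Proof.
have := @cauchy_schwarz_op id x y (fun _ _ _ => erefl) (fun _ _ => erefl).
rewrite /= => /(_ (fun z => _)) h.
have {}h : rinner x y ^+ 2 <= (rnorm x * rnorm y) ^+ 2.
  by rewrite exprMn -!rinnerxx; apply: h => z; rewrite rinnerxx exprn_ge0 ?rnorm_ge0.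
apply: le_trans (ler_norm _) _.
by rewrite -sqrtr_sqr -[leRHS](ger0_norm (mulr_ge0 (rnorm_ge0 _)
  (rnorm_ge0 _))) -sqrtr_sqr ler_wsqrtr.
Qed.

Lemma cauchy_schwarz_norm x y : `|rinner x y| <= rnorm x * rnorm y.
Proof. by rewrite ler_norml cauchy_schwarz andbT lerNl -rinnerNl -(rnormN x) cauchy_schwarz. Qed.

End RealInner.

(** * Bounded operators *)

Section Bounded.
Variables (R : realType) (H : hilbertType R).
Implicit Types (x y z : H) (r s : R) (a b c : H -> H).

Lemma bounded_opP a : bounded_op a ->
  linear a /\ exists2 K : R, 0 <= K & forall x, rnorm (a x) <= K * rnorm x.
Proof.
move=> [la [M hM]]; split=> //; exists (complex.Re `|M|).
  by rewrite -ler0c RRe_real ?normr_real// normr_ge0.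
move=> x; rewrite -lecR -rnormE.
have <- : `|M| * `|x| = (complex.Re `|M| * rnorm x)%:C.
  by rewrite rnormE -{1}(RRe_real (normr_real M)) -rmorphM.
have h0 := le_trans (normr_ge0 _) (hM x).
by move: (hM x); rewrite -(ger0_norm h0) normrM normr_id.
Qed.

Lemma bounded_op_intro a (K : R) : linear a -> (forall x, rnorm (a x) <= K * rnorm x) ->
  bounded_op a.
Proof.
by move=> la hK; split=> //; exists K%:C => x; rewrite !rnormE -rmorphM lecR.
Qed.

Lemma bounded_op_linear a : bounded_op a -> linear a. Proof. by case. Qed.

Lemma opnorm_ball a x : bounded_op a -> rnorm x <= 1 -> rnorm (a x) <= opnorm a.
Proof.
move=> /bounded_opP[la [K K0 hK]] x1; apply: ub_le_sup; last first.
  by exists x => //=; rewrite rnormE lecR.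
exists K => _ [y /= y1 <-]; rewrite -/(rnorm _).
apply: le_trans (hK y) _.
by rewrite ler_piMr// -lecR -rnormE.
Qed.

Lemma opnorm_ge0 a : bounded_op a -> 0 <= opnorm a.
Proof.
by move=> ba; apply: le_trans (rnorm_ge0 (a 0)) (opnorm_ball ba _); rewrite rnorm0.
Qed.

Lemma opnorm_ub a x : bounded_op a -> rnorm (a x) <= opnorm a * rnorm x.
Proof.
move=> ba; have la := bounded_op_linear ba.
have [->|x0] := eqVneq x 0; first by rewrite (linear_op0 la) rnorm0 mulr0.
have nx : 0 < rnorm x by rewrite lt_neqAle rnorm_ge0 eq_sym rnorm_eq0 x0.
have := @opnorm_ball a ((rnorm x)^-1%:C *: x) ba.
rewrite (linear_opZ _ _ la) !rnormZr ger0_norm ?invr_ge0 ?rnorm_ge0// mulVf ?gt_eqF//.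
by move=> /(_ (lexx _)); rewrite ler_pdivrMl// mulrC.
Qed.

Lemma opnorm_le a (B : R) : 0 <= B -> (forall x, rnorm (a x) <= B * rnorm x) -> opnorm a <= B.
Proof.
move=> B0 h; apply: ge_sup; first by exists (rnorm (a 0)), 0 => //=; rewrite normr0.
move=> _ [y /= y1 <-]; rewrite -/(rnorm _); apply: le_trans (h y) _.
by rewrite ler_piMr// -lecR -rnormE.
Qed.

Lemma bounded_add a b : bounded_op a -> bounded_op b -> bounded_op (fun x => a x + b x).
Proof.
move=> /bounded_opP[la [K K0 hK]] /bounded_opP[lb [L L0 hL]].
apply: (@bounded_op_intro _ (K + L)).
  by move=> k x y; rewrite la lb scalerDr addrACA.
by move=> x; apply: le_trans (rnormD _ _) _; rewrite mulrDl lerD.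
Qed.

Lemma bounded_scale a (k : R[i]) : bounded_op a -> bounded_op (fun x => k *: a x).
Proof.
move=> /bounded_opP[la [K K0 hK]].
apply: (@bounded_op_intro _ (complex.Re `|k| * K)).
  by move=> l x y; rewrite la scalerDr !scalerA mulrC.
move=> x; rewrite rnormZ -mulrA ler_wpM2l//.
by rewrite -ler0c RRe_real ?normr_real// normr_ge0.
Qed.

Lemma bounded_comp a b : bounded_op a -> bounded_op b -> bounded_op (fun x => a (b x)).
Proof.
move=> /bounded_opP[la [K K0 hK]] /bounded_opP[lb [L L0 hL]].
apply: (@bounded_op_intro _ (K * L)).
  by move=> k x y; rewrite lb la.
by move=> x; apply: le_trans (hK _) _; rewrite -mulrA ler_wpM2l.
Qed.

Lemma bounded_id : bounded_op (fun x : H => x).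
Proof. by apply: (@bounded_op_intro _ 1) => // x; rewrite mul1r. Qed.

Lemma bounded_scalar (k : R[i]) : bounded_op (fun x : H => k *: x).
Proof. exact: bounded_scale bounded_id. Qed.

Lemma bounded_opp a : bounded_op a -> bounded_op (fun x => - a x).
Proof.
by move=> /(bounded_scale (-1)); congr bounded_op; apply/funext => x; rewrite scaleN1r.
Qed.

Lemma bounded_sub a b : bounded_op a -> bounded_op b -> bounded_op (fun x => a x - b x).
Proof. by move=> ba /bounded_opp; exact: bounded_add. Qed.

(** Completeness, in terms of real norms and radii. *)
Lemma hilbert_cauchy (u : nat -> H) :
  (forall e : R, 0 < e -> exists N, forall n m, (N <= n)%N -> (N <= m)%N ->
    rnorm (u n - u m) <= e) ->
  exists l, forall e : R, 0 < e -> exists N, forall n, (N <= n)%N -> rnorm (u n - l) <= e.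
Proof.
move=> hu.
have cu : cvg (u @ \oo).
  apply: cauchy_cvg; apply: cauchy_exP => e e0.
  have e0' : 0 < complex.Re e by move: e0; rewrite ltcE => /andP[].
  have eE : e = (complex.Re e)%:C.
    by rewrite RRe_real// gtr0_real.
  have e2 : 0 < complex.Re e / 2 by rewrite divr_gt0.
  have [N hN] := hu _ e2.
  exists (u N); exists N => // n /= Nn.
  rewrite -ball_normE /= rnormE eE ltcR.
  by apply: le_lt_trans (hN _ _ _ _) _ => //; lra.
exists (lim (u @ \oo)) => e e0.
have := cu => /cvgrPdist_le /(_ e%:C); rewrite ltcR => /(_ e0) [N _ hN].
by exists N => n /hN /=; rewrite distrC rnormE lecR.
Qed.

End Bounded.

(** * Invertibility of coercive operators and polynomial calculus *)

Section Coercive.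
Variables (R : realType) (H : hilbertType R).
Implicit Types (x y z : H) (a b c : H -> H).

Lemma fixpoint_contraction (T : H -> H) (q : R) : 0 <= q -> q < 1 ->
  (forall x y, rnorm (T x - T y) <= q * rnorm (x - y)) -> exists x, T x = x.
Proof.
move=> q0 q1 hT.
pose u n := iter n T 0.
pose D := rnorm (u 1%N - u 0%N) / (1 - q).
have q1' : 0 < 1 - q by lra.
have D0 : 0 <= D by rewrite divr_ge0 ?rnorm_ge0// ltW.
have uD k : rnorm (u k - u 0%N) <= D.
  elim: k => [|k IH]; first by rewrite subrr rnorm0.
  have -> : u k.+1 - u 0%N = (T (u k) - T (u 0%N)) + (u 1%N - u 0%N).
    by rewrite addrA subrK.
  apply: le_trans (rnormD _ _) _; apply: le_trans (lerD (hT _ _) (lexx _)) _.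
  have -> : rnorm (u 1%N - u 0%N) = D * (1 - q) by rewrite divfK// gt_eqF.
  by nra.
have uqD k n : rnorm (u (n + k)%N - u n) <= q ^+ n * D.
  elim: n => [|n IH]; first by rewrite mul1r.
  rewrite addSn exprS -mulrA; apply: le_trans (hT _ _) _.
  by rewrite ler_wpM2l.
have [l hl] : exists l, forall e : R, 0 < e -> exists N, forall n, (N <= n)%N ->
  rnorm (u n - l) <= e.
  apply: hilbert_cauchy => e e0.
  have [N _ hN] : \forall n \near \oo, q ^+ n * D <= e.
    have /cvgrPdist_le/(_ e e0) : (fun n => q ^+ n * D) @ \oo --> 0 * D.
      by apply: cvgMl; apply: cvg_expr; rewrite ger0_norm.
    apply: filterS => n; rewrite mul0r sub0r normrN; exact: le_trans (ler_norm _).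
  exists N => n m Nn Nm.
  wlog nm : n m Nn Nm / (n <= m)%N.
    by move=> w; case: (leqP n m) => [|/ltnW] ?; [exact: w|rewrite rnormB; exact: w].
  rewrite rnormB -(subnKC nm); apply: le_trans (uqD _ _) _.
  exact: hN.
exists l; apply/eqP; rewrite -subr_eq0 -rnorm_eq0 eq_le rnorm_ge0 andbT.
apply/ler_addgt0Pr => e e0; rewrite add0r.
have [N hN] := hl (e / 2) (divr_gt0 e0 (ltr0Sn _ 1)).
have -> : T l - l = (T l - T (u N)) + (u N.+1 - l) by rewrite addrA subrK.
apply: le_trans (rnormD _ _) _; apply: le_trans (lerD (hT _ _) (lexx _)) _.
have := hN _ (leqnn N); have := hN _ (leqnSn N); rewrite (rnormB l).
have := rnorm_ge0 (u N - l); nra.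
Qed.

(** Solving [c x = y] is finding a fixed point of [x - t (c x - y)], which is a
    strict contraction for small [t]. *)
Lemma coercive_invertible c (d : R) : bounded_op c -> 0 < d ->
  (forall x, d * rnorm x ^+ 2 <= rinner (c x) x) -> invertible_op c.
Proof.
move=> bc d0 hc; have lc := bounded_op_linear bc.
have lower x : d * rnorm x <= rnorm (c x).
  have [->|x0] := eqVneq x 0; first by rewrite rnorm0 mulr0 rnorm_ge0.
  have nx : 0 < rnorm x by rewrite lt_neqAle rnorm_ge0 eq_sym rnorm_eq0 x0.
  by rewrite -(ler_pM2r nx) -mulrA -expr2; apply: le_trans (hc _) (cauchy_schwarz _ _).
have inj : injective c.
  move=> x y e; apply/eqP; rewrite -subr_eq0 -rnorm_eq0 eq_le rnorm_ge0 andbT.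
  have := lower (x - y); rewrite (linear_opB _ _ lc) e subrr rnorm0.
  by rewrite pmulr_rle0.
pose K := opnorm c + d.
have K0 : 0 < K by rewrite ltr_wpDl ?opnorm_ge0.
have hK x : rnorm (c x) <= K * rnorm x.
  by apply: le_trans (opnorm_ub x bc) _; rewrite ler_wpM2r ?rnorm_ge0// lerDl ltW.
(* This t minimizes 1 - 2 t d + t^2 K^2, a bound for the squared contraction ratio. *)
pose t := d / K ^+ 2.
have t0 : 0 < t by rewrite divr_gt0// exprn_gt0.
pose q := Num.sqrt (1 - d ^+ 2 / K ^+ 2).
have dK : d <= K by rewrite lerDr opnorm_ge0.
have tK : t * K ^+ 2 = d by rewrite divfK// gt_eqF// exprn_gt0.
have qq : 0 <= 1 - d ^+ 2 / K ^+ 2.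
  by rewrite subr_ge0 ler_pdivrMr ?exprn_gt0// mul1r lerXn2r// nnegrE ltW.
have surj y : exists x, c x = y.
  have [|||x hx] := @fixpoint_contraction (fun x => x - t%:C *: (c x - y)) q.
  - exact: sqrtr_ge0.
  - rewrite -sqrtr1 ltr_sqrt// ltrBlDr ltrDl divr_gt0// exprn_gt0//.
  - move=> x z.
    have -> : x - t%:C *: (c x - y) - (z - t%:C *: (c z - y)) = (x - z) - t%:C *: c (x - z).
      have -> : t%:C *: c (x - z) = t%:C *: (c x - y) - t%:C *: (c z - y).
        by rewrite -scalerBr opprB addrA subrK (linear_opB _ _ lc).
      by rewrite !opprB addrACA [RHS]addrACA (addrC (- z)).
    move: (x - z) => w.
    rewrite -(@ler_pXn2r _ 2)// ?nnegrE ?rnorm_ge0 ?mulr_ge0 ?sqrtr_ge0 ?rnorm_ge0//.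
    rewrite exprMn sqr_sqrtr// -!rinnerxx
      !(rinnerDl,rinnerDr,rinnerNl,rinnerNr,rinnerZl,rinnerZr) !rinnerxx.
    rewrite (rinnerC w).
    have h1 := hc w; have h2 := hK w; have w0 := rnorm_ge0 w; have c0 := rnorm_ge0 (c w).
    have h3 : rnorm (c w) ^+ 2 <=
      K ^+ 2 * rnorm w ^+ 2 by rewrite -exprMn lerXn2r// nnegrE mulr_ge0// ltW.
    have E : d ^+ 2 / K ^+ 2 = t * d by rewrite /t expr2 mulrAC.
    rewrite E.
    have h4 : t * (t * rnorm (c w) ^+ 2) <= t * (d * rnorm w ^+ 2).
      rewrite ler_pM2l// -tK -mulrA ler_pM2l//.
    have h5 : t * (d * rnorm w ^+ 2) <= t * rinner (c w) w by rewrite ler_pM2l.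
    lra.
  exists x; apply/eqP; rewrite -subr_eq0.
  move/eqP: hx; rewrite -subr_eq0 addrAC subrr add0r oppr_eq0 scaler_eq0.
  by case/orP => // /eqP /complexI tt; move: t0; rewrite tt ltxx.
have [g hg] := choice surj.
exists g; split; last 2 first.
- by move=> x; apply: inj; rewrite hg.
- by [].
apply: (@bounded_op_intro _ _ _ d^-1).
  by move=> k x y; apply: inj; rewrite lc !hg.
by move=> x; rewrite -ler_pdivrMl ?invr_gt0// invrK -{2}(hg x).
Qed.

End Coercive.

Section PolyCalculus.
Variables (R : realType) (H : hilbertType R).
Implicit Types (x y z : H) (a b c : H -> H) (p q : {poly R[i]}) (u v : {poly R}).

Definition chorner p a x : H := \sum_(k < size p) p`_k *: iter k a x.

Lemma chorner_widen n p a x : (size p <= n)%N -> chorner p a x = \sum_(k < n) p`_k *: iter k a x.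
Proof.
move=> pn; rewrite /chorner (big_ord_widen n (fun k => p`_k *: iter k a x))// big_mkcond.
by apply: eq_bigr => k _; case: ltnP => // h; rewrite nth_default// scale0r.
Qed.

Lemma chornerD p q a x : chorner (p + q) a x = chorner p a x + chorner q a x.
Proof.
pose n := maxn (size p) (size q).
rewrite (@chorner_widen n) ?size_polyD// (@chorner_widen n p) ?leq_maxl//.
rewrite (@chorner_widen n q) ?leq_maxr// -big_split; apply: eq_bigr => k _.
by rewrite coefD scalerDl.
Qed.

Lemma chornerC k a x : chorner k%:P a x = k *: x.
Proof. by rewrite (@chorner_widen 1) ?size_polyC_leq1// big_ord1 coefC. Qed.

Lemma chornerMX p a x : chorner (p * 'X) a x = chorner p a (a x).
Proof.
rewrite (@chorner_widen (size p).+1); last first.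
  by rewrite (leq_trans (size_polyMleq _ _))// size_polyX addn2.
rewrite big_ord_recl coefMX scale0r add0r; apply: eq_bigr => k _.
by rewrite coefMX /= -iterS iterSr.
Qed.

Lemma chorner_comm p a x : linear a -> chorner p a (a x) = a (chorner p a x).
Proof.
move=> la; elim/poly_ind: p x => [|p l IH] x; first by rewrite !chornerC !scale0r (linear_op0 la).
by rewrite !chornerD !chornerMX IH !chornerC (linear_opD _ _ la) (linear_opZ _ _ la).
Qed.

Lemma chornerM p q a x : linear a -> chorner (p * q) a x = chorner p a (chorner q a x).
Proof.
move=> la; elim/poly_ind: p q x => [|p l IH] q x; first by rewrite mul0r !chornerC !scale0r.
rewrite mulrDl -mulrA (mulrC 'X) chornerD IH chornerMX (chorner_comm _ _ la) chornerD chornerMX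
  chornerC; congr (_ + _).
rewrite mul_polyC; rewrite (@chorner_widen (size q)) ?size_scale_leq// /chorner scaler_sumr.
by apply: eq_bigr => i _; rewrite coefZ scalerA.
Qed.

Lemma op_hornerE u a : op_horner u a = chorner (map_poly (real_complex R) u) a.
Proof.
apply/funext => x; rewrite /op_horner /chorner size_map_poly.
by apply: eq_bigr => i _; rewrite coef_map.
Qed.

Lemma op_hornerD u v a x : op_horner (u + v) a x = op_horner u a x + op_horner v a x.
Proof. by rewrite !op_hornerE rmorphD chornerD. Qed.

Lemma op_hornerM u v a x : linear a -> op_horner (u * v) a x = op_horner u a (op_horner v a x).
Proof. by move=> la; rewrite !op_hornerE rmorphM chornerM. Qed.

Lemma op_hornerC (k : R) a x : op_horner k%:P a x = k%:C *: x.
Proof. by rewrite op_hornerE map_polyC chornerC. Qed.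

Lemma op_hornerX a x : op_horner 'X a x = a x.
Proof. by rewrite op_hornerE map_polyX -['X]mul1r chornerMX chornerC scale1r. Qed.

Lemma op_hornerN u a x : op_horner (- u) a x = - op_horner u a x.
Proof.
apply/eqP; rewrite -subr_eq0 opprK -op_hornerD addNr.
by rewrite op_hornerC scale0r.
Qed.

Lemma op_hornerB u v a x : op_horner (u - v) a x = op_horner u a x - op_horner v a x.
Proof. by rewrite op_hornerD op_hornerN. Qed.

Lemma bounded_op_horner u a : bounded_op a -> bounded_op (op_horner u a).
Proof.
move=> ba; have la := bounded_op_linear ba; elim/poly_ind: u => [|p k IH].
  have -> : op_horner 0 a = fun x => 0%:C *: x by apply/funext => x; rewrite op_hornerC.
  exact: bounded_scalar.
have -> : op_horner (p * 'X + k%:P) a = fun x => op_horner p a (a x) + k%:C *: x.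
  by apply/funext => x; rewrite op_hornerD op_hornerM// op_hornerX op_hornerC.
exact: (bounded_add (bounded_comp IH ba) (bounded_scalar _ _)).
Qed.

Lemma symmetric_op_horner u a : linear a -> symmetric_op a -> symmetric_op (op_horner u a).
Proof.
move=> la sa; elim/poly_ind: u => [|p k IH] x y.
  by rewrite !op_hornerC rinnerZl rinnerZr !mul0r.
rewrite !op_hornerD !op_hornerM// !op_hornerX !op_hornerC rinnerDl rinnerDr rinnerZl rinnerZr
  IH sa; congr (_ + _).
by rewrite !op_hornerE (chorner_comm _ _ la).
Qed.

End PolyCalculus.

(** * Spectral theory of symmetric operators *)

Section Spectrum.
Variables (R : realType) (H : hilbertType R).
Implicit Types (x y z : H) (a b c : H -> H) (p q : {poly R}).

Definition real_spectrum a (t : R) := spectrum a t%:C.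

Lemma invertible_scale c (k : R[i]) : k != 0 -> invertible_op c ->
  invertible_op (fun x => k *: c x).
Proof.
move=> k0 [g [bg cg gc]]; exists (fun x => g (k^-1 *: x)); split.
- exact: (bounded_comp bg (bounded_scalar _ _)).
- by move=> x; rewrite scalerA mulVf// scale1r.
- by move=> x; rewrite gc scalerA mulfV// scale1r.
Qed.

(** The inverse is [d] composed with the inverse of the product, which commutes
    with [c]. *)
Lemma invertible_factor c d : bounded_op d -> (forall x, c (d x) = d (c x)) ->
  invertible_op (fun x => c (d x)) -> invertible_op c.
Proof.
move=> bd cd [g [bg gK Kg]]; exists (fun x => d (g x)); split.
- exact: bounded_comp.
- move=> x; have -> : g (c x) = c (g x) by rewrite -{1}(Kg x) cd gK.
  by rewrite -cd Kg.
- by move=> x; rewrite Kg.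
Qed.

Lemma invertible_coercive_sub a (d t : R) : bounded_op a -> 0 < d ->
  (forall x, d * rnorm x ^+ 2 <= t * rnorm x ^+ 2 - rinner (a x) x) ->
    invertible_op (fun x => a x - t%:C *: x).
Proof.
move=> ba d0 h.
have -> : (fun x => a x - t%:C *: x) = (fun x => (-1) *: (t%:C *: x - a x)).
  by apply/funext => x; rewrite scaleN1r opprB.
apply: invertible_scale; first by rewrite oppr_eq0 oner_neq0.
apply: (coercive_invertible _ d0).
  exact: (bounded_sub (bounded_scalar _ _) ba).
by move=> x; rewrite rinnerDl rinnerNl rinnerZl rinnerxx.
Qed.

(** Outside the numerical range, [a - t] or its opposite is coercive. *)
Lemma real_spectrum_range a (m M t : R) : bounded_op a ->
  (forall x, m * rnorm x ^+ 2 <= rinner (a x) x) ->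
    (forall x, rinner (a x) x <= M * rnorm x ^+ 2) ->
  real_spectrum a t -> m <= t /\ t <= M.
Proof.
move=> ba hm hM st; split; rewrite leNgt; apply/negP => h; apply: st.
- apply: (@coercive_invertible _ _ _ (m - t)); last 2 first.
  + by rewrite subr_gt0.
  + by move=> x; rewrite rinnerDl rinnerNl rinnerZl rinnerxx mulrBl lerB.
  + exact: (bounded_sub ba (bounded_scalar _ _)).
- apply: (@invertible_coercive_sub _ (t - M)) => //; first by rewrite subr_gt0.
  by move=> x; rewrite mulrBl lerB.
Qed.

Lemma opnormN a : opnorm (fun x => - a x) = opnorm a.
Proof.
rewrite /opnorm; congr sup; apply/seteqP; split => _ [x x1 <-]; exists x => //.
  by rewrite normrN.
by rewrite normrN.
Qed.

(** If |p(t)| exceeded ||p(a)||, then p(t) - p(a) would be coercive, hence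
    invertible; but a - t is a factor of it. *)
Lemma real_spectrum_horner_le a p t : bounded_op a -> real_spectrum a t ->
  `|p.[t]| <= opnorm (op_horner p a).
Proof.
move=> ba st; have la := bounded_op_linear ba.
wlog pt : p / 0 <= p.[t].
  move=> w; case: (leP 0 p.[t]) => [|h]; first exact: w.
  have := w (- p); rewrite hornerN normrN oppr_ge0 => /(_ (ltW h)).
  by rewrite (_ : op_horner _ _ = fun x => - op_horner p a x) ?opnormN//; apply/funext => x;
    rewrite op_hornerN.
rewrite ger0_norm// leNgt; apply/negP => h; apply: st.
have bp := bounded_op_horner p ba.
have /factor_theorem[r hr] : root (p - p.[t]%:P) t by rewrite rootE !hornerE subrr.
apply: (@invertible_factor _ (op_horner r a)); first exact: bounded_op_horner.
  by move=> x; rewrite (linear_opB _ _ (bounded_op_linear (bounded_op_horner r ba)))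
    (linear_opZ _ _ (bounded_op_linear (bounded_op_horner r ba))) !op_hornerE (chorner_comm _ _
      la).
have -> : (fun x => a (op_horner r a x) - t%:C *: op_horner r a x) = (fun x =>
  op_horner p a x - (p.[t])%:C *: x).
  apply/funext => x; rewrite -[RHS](_ : op_horner (p - p.[t]%:P) a x = _); last first.
    by rewrite op_hornerB op_hornerC.
  by rewrite hr mulrC op_hornerM// op_hornerB op_hornerX op_hornerC.
apply: (@invertible_coercive_sub _ (p.[t] - opnorm (op_horner p a))) => //.
  by rewrite subr_gt0.
move=> x; rewrite mulrBl lerB//; apply: le_trans (cauchy_schwarz _ _) _.
by rewrite expr2 mulrA ler_wpM2r ?rnorm_ge0// opnorm_ub.
Qed.

Lemma rnorm_i x : rnorm ('i%C *: x) = rnorm x.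
Proof.
apply/eqP; rewrite -(@eqrXn2 _ 2) ?rnorm_ge0//.
by rewrite -!rinnerxx rinner_ii.
Qed.

(** A real [l] outside the spectrum is covered by the bounded inverse; a
    non-real [l] by the imaginary part of the form of [a - l], which is
    - Im l times the squared norm. *)
Lemma bounded_below_sub a (l : R[i]) : bounded_op a -> symmetric_op a ->
  (forall t, l = t%:C -> ~ real_spectrum a t) ->
  exists2 d : R, 0 < d & forall x, d * rnorm x <= rnorm (a x - l *: x).
Proof.
move=> ba sa; have la := bounded_op_linear ba; case: l => u v hl.
have [v0|v0] := eqVneq v 0.
  have /contrapT [g [bg gK _]] := hl u (congr1 _ v0).
  exists (opnorm g + 1)^-1; first by rewrite invr_gt0 ltr_wpDl// opnorm_ge0.
  move=> x; rewrite ler_pdivrMl ?ltr_wpDl ?opnorm_ge0// v0.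
  rewrite -{1}(gK x); apply: le_trans (opnorm_ub _ bg) _.
  by rewrite ler_wpM2r ?rnorm_ge0// lerDl.
exists `|v|; first by rewrite normr_gt0.
move=> x; have [->|x0] := eqVneq x 0; first by rewrite rnorm0 mulr0 rnorm_ge0.
have nx : 0 < rnorm x by rewrite lt_neqAle rnorm_ge0 eq_sym rnorm_eq0 x0.
rewrite -(ler_pM2r nx) -mulrA -expr2 -{2}(rnorm_i x).
apply: le_trans (cauchy_schwarz_norm _ _).
have -> : (u +i* v) *: x = u%:C *: x + v%:C *: ('i%C *: x).
  rewrite scalerA -scalerDl; congr (_ *: _).
  by rewrite [LHS]complexE /= mulrC.
rewrite rinnerDl rinnerNl rinnerDl !rinnerZl symmetric_rinner_i// (@symmetric_rinner_i _ _ id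
  x)// rinnerxx rnorm_i.
by rewrite mulr0 !add0r normrN normrM (@ger0_norm _ (rnorm x ^+ 2))// exprn_ge0 ?rnorm_ge0.
Qed.

(** Factor [q] into linear factors over the complex numbers: each factor is
    bounded below, so their product is. *)
Lemma bounded_below_horner a q : bounded_op a -> symmetric_op a -> q != 0 ->
  (forall t, real_spectrum a t -> ~~ root q t) ->
  exists2 d : R, 0 < d & forall x, d * rnorm x <= rnorm (op_horner q a x).
Proof.
move=> ba sa q0 hq; have la := bounded_op_linear ba.
pose qc := map_poly (real_complex R) q.
have qc0 : qc != 0 by rewrite map_poly_eq0.
have [r hr] := closed_field_poly_normal qc.
have hz (z : R[i]) : z \in r -> forall t, z = t%:C -> ~ real_spectrum a t.
  move=> zr t zt /hq; apply/negP; rewrite negbK.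
  have : root qc t%:C by rewrite hr -zt rootZ ?lead_coef_eq0// root_prod_XsubC.
  by rewrite fmorph_root.
have [d d0 hd] : exists2 d : R, 0 < d & forall x,
  d * rnorm x <= rnorm (chorner (\prod_(z <- r) ('X - z%:P)) a x).
  elim: r hz {hr} => [|z r IH] hz.
    by exists 1 => // x; rewrite big_nil chornerC scale1r mul1r.
  have [d d0 hd] := IH (fun w wr => hz w (mem_behead (s := z :: r) wr)).
  have [d' d0' hd'] := bounded_below_sub ba sa (hz z (mem_head _ _)).
  exists (d' * d); first exact: mulr_gt0.
  move=> x; rewrite big_cons chornerM//.
  have -> y : chorner ('X - z%:P) a y = a y - z *: y.
    by rewrite chornerD -polyCN chornerC scaleNr -['X]mul1r chornerMX chornerC scale1r.
  by apply: le_trans (hd' _); rewrite -mulrA ler_pM2l.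
have l0 : 0 < complex.Re `|lead_coef qc|.
  by rewrite -ltcR RRe_real ?normr_real// normr_gt0 lead_coef_eq0.
exists (complex.Re `|lead_coef qc| * d); first exact: mulr_gt0.
move=> x; rewrite op_hornerE -/qc hr -mul_polyC chornerM// chornerC rnormZ -mulrA.
rewrite -mul_polyC in hr; rewrite -hr.
by rewrite ler_pM2l.
Qed.

Section SpectralBound.
Variables (a : H -> H) (ba : bounded_op a) (sa : symmetric_op a).

(** With N = ||p(a)||, the operator p(a)^2 - N^2 is not bounded below, as one
    sees on unit vectors x with ||p(a) x|| close to N. By
    [bounded_below_horner], p^2 - N^2 has a root in the spectrum. *)
Lemma opnorm_op_horner_attained_aux p (e : H) : e != 0 ->
  p ^+ 2 - (opnorm (op_horner p a) ^+ 2)%:P != 0 ->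
  exists2 t, real_spectrum a t & `|p.[t]| = opnorm (op_horner p a).
Proof.
move=> e0; have la := bounded_op_linear ba.
set N := opnorm _; set q := _ - _ => q0.
have bp := bounded_op_horner p ba; have N0 : 0 <= N := opnorm_ge0 bp.
apply: contrapT => hn.
have [|d d0 hd] := bounded_below_horner ba sa q0.
  move=> t st; apply/negP => /eqP qt; apply: hn; exists t => //.
  apply/eqP; rewrite -(@eqrXn2 _ 2)//; rewrite real_normK ?num_real//.
  by rewrite -subr_eq0; apply/eqP; move: qt; rewrite /q !hornerE.
have h x : N ^+ 2 * rnorm (op_horner p a x) ^+ 2 <= (N ^+ 4 - d ^+ 2) * rnorm x ^+ 2.
  have := hd x; rewrite /q op_hornerB expr2 op_hornerM// op_hornerC.
  set y := op_horner p a x => hx.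
  have {}hx : (d * rnorm x) ^+ 2 <= rnorm (op_horner p a y - (N ^+ 2)%:C *: x) ^+ 2.
    by rewrite lerXn2r// nnegrE ?rnorm_ge0// mulr_ge0 ?rnorm_ge0 ?(ltW d0).
  move: hx; rewrite -(rinnerxx (_ - _)) !(rinnerDl, rinnerDr, rinnerNl, rinnerNr, rinnerZl,
    rinnerZr).
  rewrite !(rinnerC x) (symmetric_op_horner p la sa y x) -/y !rinnerxx.
  have : rnorm (op_horner p a y) ^+ 2 <= (N * rnorm y) ^+ 2.
    by rewrite lerXn2r// ?nnegrE ?rnorm_ge0// ?mulr_ge0 ?rnorm_ge0// opnorm_ub.
  have -> : N ^+ 4 = N ^+ 2 * N ^+ 2 by rewrite -exprD.
  rewrite !exprMn; lra.
have e1 : 0 < rnorm e by rewrite lt_neqAle rnorm_ge0 eq_sym rnorm_eq0 e0.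
have [NN|NN] := eqVneq N 0.
  have := h e; rewrite NN !expr0n/= mul0r sub0r mulNr oppr_ge0 leNgt.
  by rewrite mulr_gt0// exprn_gt0.
have N1 : 0 < N by rewrite lt_neqAle eq_sym NN.
pose s := Num.sqrt (N ^+ 2 - d ^+ 2 / N ^+ 2).
have N2 : 0 < N ^+ 2 by rewrite exprn_gt0.
have d2 : 0 < d ^+ 2 / N ^+ 2 by rewrite divr_gt0// exprn_gt0.
have E : N ^+ 2 * (N ^+ 2 - d ^+ 2 / N ^+ 2) = N ^+ 4 - d ^+ 2.
  by rewrite mulrBr -exprD (mulrCA _ (d ^+ 2)) mulfV ?gt_eqF// mulr1.
have h' x : rnorm (op_horner p a x) ^+ 2 <= (N ^+ 2 - d ^+ 2 / N ^+ 2) * rnorm x ^+ 2.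
  by rewrite -(ler_pM2l N2) [leRHS]mulrA E.
have s0 : 0 <= N ^+ 2 - d ^+ 2 / N ^+ 2.
  have := le_trans (exprn_ge0 2 (rnorm_ge0 _)) (h' e).
  by rewrite pmulr_lge0// exprn_gt0.
have : N <= s.
  apply: opnorm_le; first exact: sqrtr_ge0.
  move=> x; rewrite -(@ler_pXn2r _ 2)// ?nnegrE ?rnorm_ge0 ?mulr_ge0 ?sqrtr_ge0 ?rnorm_ge0//.
  by rewrite exprMn sqr_sqrtr.
rewrite leNgt => /negP; apply.
rewrite -[ltRHS](ger0_norm N0) -sqrtr_sqr ltr_sqrt//; lra.
Qed.

(** The case p^2 = N^2 left out above only asks for the spectrum to be
    nonempty, which is the previous lemma for the polynomial X. *)
Lemma opnorm_op_horner_attained p (e : H) : e != 0 ->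
  exists2 t, real_spectrum a t & `|p.[t]| = opnorm (op_horner p a).
Proof.
move=> e0.
have [pN|] := eqVneq (p ^+ 2 - (opnorm (op_horner p a) ^+ 2)%:P) 0; last first.
  exact: opnorm_op_horner_attained_aux e0.
have [|t st _] := @opnorm_op_horner_attained_aux 'X e e0.
  apply/eqP => /(congr1 (fun q : {poly R} => q`_2)).
  by rewrite coefB coefXn coefC coef0 /= subr0 => /eqP; rewrite oner_eq0.
exists t => //; apply/eqP; rewrite -(@eqrXn2 _ 2) ?opnorm_ge0//; last exact: bounded_op_horner.
rewrite real_normK ?num_real// -subr_eq0.
by move/(congr1 (fun q : {poly R} => q.[t])) : pN; rewrite !hornerE => ->.
Qed.

Lemma opnorm_op_horner_le p B : 0 <= B -> (forall t, real_spectrum a t -> `|p.[t]| <= B) ->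
  opnorm (op_horner p a) <= B.
Proof.
move=> B0 h; case: (pselect (exists e : H, e != 0)) => [[e e0]|ne].
  by have [t st <-] := opnorm_op_horner_attained p e0; exact: h.
apply: opnorm_le => // x; have -> : x = 0.
  by apply/eqP; apply: contrapT => /negP x0; apply: ne; exists x.
by rewrite (linear_op0 (bounded_op_linear (bounded_op_horner p ba))) rnorm0 mulr0.
Qed.

End SpectralBound.
End Spectrum.

(** * Continuous functional calculus *)

Section FunctionalCalculus.
Variables (R : realType) (H : hilbertType R).
Implicit Types (x y z : H) (p q : {poly R}) (f g : R -> R).

Lemma rnorm_chain (u v w : H) (d1 d2 : R) : rnorm (u - v) <= d1 -> rnorm (v - w) <= d2 ->
  rnorm (u - w) <= d1 + d2.
Proof.
move=> h1 h2; have -> : u - w = (u - v) + (v - w) by rewrite addrA subrK.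
by apply: le_trans (rnormD _ _) _; exact: lerD.
Qed.

Lemma rnorm_eps_eq0 (u : H) (K : R) : (forall e : R, 0 < e -> rnorm u <= K * e) -> u = 0.
Proof.
move=> h; apply/eqP; rewrite -rnorm_eq0 eq_le rnorm_ge0 andbT.
apply/ler_addgt0Pr => e e0; rewrite add0r.
have K1 : 0 < `|K| + 1 by rewrite ltr_wpDl.
apply: le_trans (h (e / (`|K| + 1)) (divr_gt0 e0 K1)) _.
rewrite mulrCA -[leRHS]mulr1 ler_pM2l// ler_pdivrMr// mul1r.
by apply: le_trans (ler_norm _) _; rewrite lerDl.
Qed.

Section FixedOperator.
Variables (a : H -> H) (ba : bounded_op a) (sa : symmetric_op a).
Implicit Types (b c : H -> H).

Lemma is_fcalcP f b : is_fcalc f a b -> bounded_op b /\ forall e : R, 0 < e ->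
  exists p, (forall t, real_spectrum a t -> `|f t - p.[t]| <= e) /\
            forall x, rnorm (b x - op_horner p a x) <= e * rnorm x.
Proof.
move=> [bb h]; split=> // e e0; have [p [hp hb]] := h e e0.
exists p; split=> // x.
apply: (@le_trans _ _ (opnorm (fun x : H => b x - op_horner p a x) * rnorm x)).
  apply: (@opnorm_ub _ _ (fun x : H => b x - op_horner p a x)).
  exact: bounded_sub bb (bounded_op_horner _ ba).
by rewrite ler_wpM2r ?rnorm_ge0.
Qed.

Lemma rnorm_op_horner_le p B x : 0 <= B -> (forall t, real_spectrum a t -> `|p.[t]| <= B) ->
  rnorm (op_horner p a x) <= B * rnorm x.
Proof.
move=> B0 h; apply: le_trans (opnorm_ub x (bounded_op_horner p ba)) _.
by rewrite ler_wpM2r ?rnorm_ge0// opnorm_op_horner_le.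
Qed.

(** Two polynomials that are close to each other on the spectrum give close
    operators, so the value of the functional calculus is determined by the
    restriction of the function to the spectrum. *)
Lemma is_fcalc_uniq f g b c : is_fcalc f a b -> is_fcalc g a c ->
  (forall t, real_spectrum a t -> f t = g t) -> b = c.
Proof.
move=> /is_fcalcP[bb hb] /is_fcalcP[bc hc] fg; apply/funext => x.
apply/eqP; rewrite -subr_eq0; apply/eqP; apply: (@rnorm_eps_eq0 _ (4 * rnorm x)) => e e0.
have [p [hp1 hp2]] := hb e e0; have [q [hq1 hq2]] := hc e e0.
have h1 : rnorm (op_horner p a x - op_horner q a x) <= (2 * e) * rnorm x.
  rewrite -op_hornerB; apply: rnorm_op_horner_le => [|t st]; first by rewrite mulr_ge0// ltW.
  rewrite hornerD hornerN; have := hp1 t st; have := hq1 t st.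
  rewrite (fg _ st) !ler_norml => /andP[??] /andP[??]; apply/andP; split; lra.
have := hq2 x; rewrite rnormB => h2.
have := rnorm_chain (rnorm_chain (hp2 x) h1) h2; lra.
Qed.

Lemma is_fcalc_ge f b t : is_fcalc f a b -> real_spectrum a t -> `|f t| <= opnorm b.
Proof.
move=> /is_fcalcP[bb hb] st; apply/ler_addgt0Pr => e e0.
have e2 : 0 < e / 2 by rewrite divr_gt0.
have [p [hp1 hp2]] := hb _ e2.
have h1 := real_spectrum_horner_le p ba st.
have h2 : opnorm (op_horner p a) <= opnorm b + e / 2.
  apply: opnorm_le; first by rewrite addr_ge0 ?opnorm_ge0// ltW.
  move=> x; have := rnormD (op_horner p a x - b x) (b x); rewrite subrK rnormB.
  have := hp2 x; have := opnorm_ub x bb; lra.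
have := hp1 t st; move: h1; rewrite !ler_norml => /andP[??] /andP[??]; apply/andP; split; lra.
Qed.

Lemma is_fcalc_le f b B : is_fcalc f a b -> 0 <= B -> (forall t, real_spectrum a t ->
  `|f t| <= B) ->
  opnorm b <= B.
Proof.
move=> /is_fcalcP[bb hb] B0 hB; apply/ler_addgt0Pr => e e0.
have e2 : 0 < e / 2 by rewrite divr_gt0.
have [p [hp1 hp2]] := hb _ e2.
apply: opnorm_le; first by rewrite addr_ge0// ltW.
move=> x; have h3 : rnorm (op_horner p a x) <= (B + e / 2) * rnorm x.
  apply: rnorm_op_horner_le; first by rewrite addr_ge0// ltW.
  move=> t st; have := hp1 t st; have := hB t st.
  rewrite !ler_norml => /andP[??] /andP[??]; apply/andP; split; lra.
have := rnormD (b x - op_horner p a x) (op_horner p a x); rewrite subrK.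
have := hp2 x; lra.
Qed.

(** Errors may be collected with a common factor [K], with no tuning of the
    initial [e]. *)
Lemma is_fcalc_weak f b (K : R) : bounded_op b ->
  (forall e : R, 0 < e -> e <= 1 -> exists p, (forall t, real_spectrum a t ->
    `|f t - p.[t]| <= K * e) /\
            forall x, rnorm (b x - op_horner p a x) <= K * e * rnorm x) -> is_fcalc f a b.
Proof.
move=> bb h; split=> // e e0.
have K1 : 0 < `|K| + 1 by rewrite ltr_wpDl.
pose e' := Num.min 1 (e / (`|K| + 1)).
have e'0 : 0 < e' by rewrite lt_min ltr01 divr_gt0.
have e'1 : e' <= 1 by rewrite ge_min lexx.
have Ke : K * e' <= e.
  apply: (@le_trans _ _ ((`|K| + 1) * e')).
    by rewrite ler_wpM2r ?(ltW e'0)// (le_trans (ler_norm _))// lerDl.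
  by rewrite -ler_pdivlMl// mulrC ge_min lexx orbT.
have [p [h1 h2]] := h _ e'0 e'1; exists p; split.
  by move=> t /h1 h'; exact: le_trans h' Ke.
apply: (@opnorm_le _ _ (fun x => b x - op_horner p a x)); first exact: ltW.
by move=> x; apply: le_trans (h2 x) _; rewrite ler_wpM2r ?rnorm_ge0.
Qed.

Lemma is_fcalc_mul f g b c : is_fcalc f a b -> is_fcalc g a c ->
  is_fcalc (fun t => f t * g t) a (fun x => b (c x)).
Proof.
move=> fb gc; have /is_fcalcP[bb hb] := fb; have /is_fcalcP[bc hc] := gc.
pose B := opnorm b; pose C := opnorm c.
have B0 : 0 <= B by exact: opnorm_ge0. have C0 : 0 <= C by exact: opnorm_ge0.
have la := bounded_op_linear ba.
apply: (@is_fcalc_weak _ _ (B + C + 1)); first exact: bounded_comp.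
move=> e e0 e1; have [p [hp1 hp2]] := hb e e0; have [q [hq1 hq2]] := hc e e0.
exists (p * q); split.
  move=> t st; rewrite hornerM.
  have -> : f t * g t - p.[t] * q.[t] =
    f t * (g t - q.[t]) + (f t - p.[t]) * (g t - (g t - q.[t])) by ring.
  have hf := is_fcalc_ge fb st; have hg := is_fcalc_ge gc st.
  apply: le_trans (ler_normD _ _) _; rewrite !normrM.
  have h3 : `|f t| * `|g t - q.[t]| <= B * e by apply: ler_pM => //; exact: hq1.
  have h4 : `|f t - p.[t]| * `|g t - (g t - q.[t])| <= e * (C + e).
    apply: ler_pM => //; first exact: hp1.
    apply: le_trans (ler_normB _ _) _; apply: lerD => //; exact: hq1.
  nra.
move=> x; rewrite op_hornerM//.
set w := op_horner q a x.
have h1 : rnorm (b (c x) - b w) <= B * (e * rnorm x).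
  rewrite -(linear_opB _ _ (bounded_op_linear bb)); apply: le_trans (opnorm_ub _ bb) _.
  by rewrite ler_wpM2l// hq2.
have h2 : rnorm w <= (C + e) * rnorm x.
  have := rnormD (w - c x) (c x); rewrite subrK rnormB.
  have := hq2 x; have := opnorm_ub x bc; rewrite -/C -/w; lra.
have h3 : rnorm (b w - op_horner p a w) <= e * ((C + e) * rnorm x).
  by apply: le_trans (hp2 _) _; rewrite ler_pM2l.
apply: le_trans (rnorm_chain h1 h3) _.
have := rnorm_ge0 x => x0.
have : e * (e * rnorm x) <= e * rnorm x by rewrite ler_pM2l// ler_piMl.
lra.
Qed.

Lemma is_fcalc_symmetric f b : is_fcalc f a b -> symmetric_op b.
Proof.
move=> /is_fcalcP[bb hb] x y.
apply/eqP; rewrite -subr_eq0 -normr_eq0 eq_le normr_ge0 andbT.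
apply/ler_addgt0Pr => e e0; rewrite add0r.
pose K := 2 * (rnorm x * rnorm y) + 1.
have xy0 : 0 <= rnorm x * rnorm y by rewrite mulr_ge0 ?rnorm_ge0.
have K0 : 0 < K by rewrite /K; lra.
have [p [_ hp]] := hb (e / K) (divr_gt0 e0 K0).
have -> : rinner (b x) y - rinner x (b y) =
  rinner (b x - op_horner p a x) y - rinner x (b y - op_horner p a y).
  rewrite !(rinnerDl, rinnerDr, rinnerNl, rinnerNr)
    (symmetric_op_horner p (bounded_op_linear ba) sa); lra.
apply: le_trans (ler_normB _ _) _.
have h1 : `|rinner (b x - op_horner p a x) y| <= e / K * rnorm x * rnorm y.
  by apply: le_trans (cauchy_schwarz_norm _ _) _; rewrite ler_wpM2r ?rnorm_ge0// hp.
have h2 : `|rinner x (b y - op_horner p a y)| <= rnorm x * (e / K * rnorm y).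
  by apply: le_trans (cauchy_schwarz_norm _ _) _; rewrite ler_wpM2l ?rnorm_ge0// hp.
apply: le_trans (lerD h1 h2) _.
have -> : e / K * rnorm x * rnorm y + rnorm x * (e / K * rnorm y) =
  e / K * (2 * (rnorm x * rnorm y)) by ring.
have {2}-> : e = e / K * K by rewrite divfK// gt_eqF.
by rewrite ler_pM2l ?divr_gt0// /K lerDl.
Qed.

Lemma is_fcalc_horner p : is_fcalc (fun t => p.[t]) a (op_horner p a).
Proof.
apply: (@is_fcalc_weak _ _ 1); first exact: bounded_op_horner.
move=> e e0 _; exists p; split=> [t _|x]; first by rewrite subrr normr0 mul1r ltW.
by rewrite subrr rnorm0 mulr_ge0 ?rnorm_ge0// mul1r ltW.
Qed.

Lemma is_fcalc_id : is_fcalc id a a.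
Proof.
have := is_fcalc_horner 'X.
have -> : op_horner 'X a = a by apply/funext => x; rewrite op_hornerX.
by congr is_fcalc; apply/funext => t; rewrite hornerX.
Qed.

Lemma is_fcalc_cst (k : R) : is_fcalc (fun=> k) a (fun x => k%:C *: x).
Proof.
have := is_fcalc_horner k%:P.
have -> : op_horner k%:P a = fun x => k%:C *: x by apply/funext => x; rewrite op_hornerC.
by congr is_fcalc; apply/funext => t; rewrite hornerC.
Qed.

Lemma fcalcE f b : is_fcalc f a b -> fcalc f a = b.
Proof.
move=> fb; have /(is_fcalc_uniq fb) h : is_fcalc f a (fcalc f a) by exact: (xgetPex _ (ex_intro
  _ b fb)).
by rewrite -h.
Qed.

Lemma fcalc_eq_on f g b : is_fcalc g a b -> (forall t, real_spectrum a t -> f t = g t) ->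
  is_fcalc f a b.
Proof.
move=> [bb h] fg; split=> // e /h[p [h1 h2]]; exists p; split=> // t st.
by rewrite fg// h1.
Qed.

(** This covers functions without a value at [a], for which [fcalc f a] is the
    zero operator. *)
Lemma opnorm_fcalc_le f B : 0 <= B -> (forall t, real_spectrum a t -> `|f t| <= B) ->
  opnorm (fcalc f a) <= B.
Proof.
move=> B0 hB; rewrite /fcalc; case: xgetP => [b _ fb|_]; first exact: is_fcalc_le fb _ _.
by apply: opnorm_le => // x; rewrite /= rnorm0 mulr_ge0 ?rnorm_ge0.
Qed.

(** Polynomials converging uniformly on the spectrum give a Cauchy sequence of
    operators, whose pointwise limit is the value of the calculus. *)
Lemma fcalc_ex f : (forall e : R, 0 < e -> exists p, forall t, real_spectrum a t ->
  `|f t - p.[t]| <= e) ->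
  is_fcalc f a (fcalc f a).
Proof.
move=> h.
have [P hP] : exists P : nat -> {poly R}, forall n t, real_spectrum a t ->
  `|f t - (P n).[t]| <= n.+1%:R^-1.
  have /choice[P hP] : forall n : nat, exists p, forall t, real_spectrum a t ->
    `|f t - p.[t]| <= n.+1%:R^-1.
    by move=> n; apply: h; rewrite invr_gt0.
  by exists P.
have [eps epsP] : exists eps : nat -> R, forall n, eps n = n.+1%:R^-1 by eexists.
have eps0 n : 0 <= eps n by rewrite epsP.
have {}hP n t : real_spectrum a t -> `|f t - (P n).[t]| <= eps n by rewrite epsP; exact: hP.
have hC x n m : rnorm (op_horner (P n) a x - op_horner (P m) a x) <= (eps n + eps m) * rnorm x.
  rewrite -op_hornerB; apply: rnorm_op_horner_le; first by rewrite addr_ge0.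
  move=> t st; rewrite hornerD hornerN; have := hP n t st; have := hP m t st.
  rewrite !ler_norml => /andP[??] /andP[??]; apply/andP; split; lra.
have inve (e : R) : 0 < e -> exists N, forall n, (N <= n)%N -> eps n <= e.
  move=> e0; have [N _ hN] := near_infty_natSinv_lt (PosNum e0).
  by exists N => n Nn; rewrite epsP ltW//; exact: hN.
have inve2 (e : R) x : 0 < e -> exists N, forall n, (N <= n)%N -> eps n * rnorm x <= e.
  move=> e0; have x1 : 0 < rnorm x + 1 by rewrite ltr_wpDl ?rnorm_ge0.
  have [N hN] := inve _ (divr_gt0 e0 x1); exists N => n /hN.
  rewrite ler_pdivlMr//; apply: le_trans; apply: ler_wpM2l => //.
  by rewrite lerDl.
have /choice[b hb] : forall x, exists l, forall e : R, 0 < e -> exists N, forall n, (N <= n)%N ->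
    rnorm (op_horner (P n) a x - l) <= e.
  move=> x; apply: hilbert_cauchy => e e0.
  have [N hN] := inve2 (e / 2) x (divr_gt0 e0 (ltr0Sn _ 1)).
  exists N => n m /hN h1 /hN h2; apply: le_trans (hC _ _ _) _; lra.
have hbP x n : rnorm (op_horner (P n) a x - b x) <= eps n * rnorm x.
  apply/ler_addgt0Pr => e e0; have e2 : 0 < e / 2 by rewrite divr_gt0.
  have [N1 hN1] := inve2 _ x e2; have [N2 hN2] := hb x _ e2.
  have := hN1 _ (leq_maxl N1 N2); have := hN2 _ (leq_maxr N1 N2).
  set m := maxn _ _ => h1 h2; have := rnorm_chain (hC x n m) h1; lra.
have lb : linear b.
  move=> k x y; apply/eqP; rewrite -subr_eq0; apply/eqP.
  pose K := rnorm (k *: x + y) + complex.Re `|k| * rnorm x + rnorm y.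
  apply: (@rnorm_eps_eq0 _ K) => e e0; have [N hN] := inve _ e0.
  have {hN}eN := hN _ (leqnn N).
  have h1 := hbP (k *: x + y) N; have h2 := hbP x N; have h3 := hbP y N.
  have lP := bounded_op_linear (bounded_op_horner (P N) ba).
  rewrite lP rnormB in h1.
  have h4 : rnorm (k *: op_horner (P N) a x + op_horner (P N) a y - (k *: b x + b y)) <=
      complex.Re `|k| * (eps N * rnorm x) + eps N * rnorm y.
    rewrite opprD addrACA -scalerBr; apply: le_trans (rnormD _ _) _.
    rewrite rnormZ lerD// ler_wpM2l//.
    by rewrite -ler0c RRe_real ?normr_real// normr_ge0.
  apply: le_trans (rnorm_chain h1 h4) _.
  have -> : eps N * rnorm (k *: x + y) + (complex.Re `|k| * (eps N * rnorm x) +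
    eps N * rnorm y) = K * eps N.
    by rewrite /K; ring.
  by rewrite ler_wpM2l// /K !addr_ge0 ?mulr_ge0 ?rnorm_ge0// -ler0c RRe_real ?normr_real//
    normr_ge0.
have bb : bounded_op b.
  apply: (@bounded_op_intro _ _ _ (opnorm (op_horner (P 0%N) a) + eps 0%N)) => // x.
  have := opnorm_ub x (bounded_op_horner (P 0%N) ba).
  have := hbP x 0%N; rewrite rnormB.
  have := rnormD (b x - op_horner (P 0%N) a x) (op_horner (P 0%N) a x); rewrite subrK; lra.
have fb : is_fcalc f a b.
  apply: (@is_fcalc_weak _ _ 1) => // e e0 _; rewrite mul1r.
  have [N hN] := inve _ e0; exists (P N); split.
    by move=> t st; apply: le_trans (hP _ _ st) _; exact: hN.
  by move=> x; rewrite rnormB; apply: le_trans (hbP _ _) _; rewrite ler_wpM2r ?rnorm_ge0// hN.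
by rewrite (fcalcE fb).
Qed.

End FixedOperator.
End FunctionalCalculus.

(** * Polynomial approximation of Lipschitz functions *)

Section Bernstein.
Variable R : realType.
Implicit Types (phi psi : nat -> R) (t : R).

(** The expectation of [phi] under the binomial law of parameters [n] and X, as
    a polynomial. Conditioning on the first trial, instead of summing with
    binomial coefficients, reduces every identity below to an induction on [n]
    closed by [ring]. *)
Fixpoint bernstein n phi : {poly R} :=
  if n is n'.+1 then 'X * bernstein n' (fun k => phi k.+1) + (1 - 'X) * bernstein n' phi
  else (phi 0%N)%:P.

Lemma bernsteinS n phi t : (bernstein n.+1 phi).[t] =
  t * (bernstein n (fun k => phi k.+1)).[t] + (1 - t) * (bernstein n phi).[t].
Proof. by rewrite /= !hornerE. Qed.

Lemma bernstein_le n phi psi t : 0 <= t -> t <= 1 ->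
  (forall k, (k <= n)%N -> phi k <= psi k) -> (bernstein n phi).[t] <= (bernstein n psi).[t].
Proof.
move=> t0 t1; elim: n phi psi => [|n IH] phi psi h; first by rewrite !hornerC h.
rewrite !bernsteinS lerD// ler_wpM2l ?subr_ge0//; apply: IH => k kn; apply: h => //.
by rewrite ltnW.
Qed.

Lemma bernstein_affine n phi (r s t : R) :
  (bernstein n (fun k => r * phi k + s)).[t] = r * (bernstein n phi).[t] + s.
Proof.
elim: n phi => [|n IH] phi; first by rewrite !hornerC.
by rewrite !bernsteinS !IH; ring.
Qed.

Lemma bernstein_variance n (r t : R) :
  (bernstein n (fun k => (k%:R + r) ^+ 2)).[t] = (n%:R * t + r) ^+ 2 + n%:R * t * (1 - t).
Proof.
elim: n r => [|n IH] r; first by rewrite hornerC; ring.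
rewrite bernsteinS IH.
have -> : (fun k : nat => (k.+1%:R + r) ^+ 2) = (fun k => (k%:R + (1 + r)) ^+ 2).
  by apply/funext => k; rewrite -natr1 addrA.
by rewrite IH -natr1; ring.
Qed.

(** Since |u| <= (u^2 / d + d) / 2, the value of a Lipschitz function at k/n
    differs from its value at t by at most an affine function of (k/n - t)^2,
    whose expectation is known: it is t (1 - t) / n. *)
Lemma bernstein_approx (h : R -> R) (L : R) (e : R) : 0 <= L -> 0 < e ->
  (forall s t : R, 0 <= s <= 1 -> 0 <= t <= 1 -> `|h s - h t| <= L * `|s - t|) ->
  exists p : {poly R}, forall t, 0 <= t <= 1 -> `|h t - p.[t]| <= e.
Proof.
move=> L0 e0 hL.
pose d := e / (L + 1).
have L1 : 0 < L + 1 by rewrite ltr_wpDl.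
have d0 : 0 < d by rewrite divr_gt0.
have Ld : L * d <= e.
  by rewrite mulrC /d mulrAC -mulrA ler_piMr ?(ltW e0)// mulrC ler_pdivrMl// mulr1 lerDl.
have [n n0 hn] : exists2 n : nat, (0 < n)%N & L / d <= e * n%:R.
  have [N hN] : exists N : nat, L / d / e < N%:R.
    exists (Num.bound (L / d / e)); apply: archi_boundP.
    by rewrite !divr_ge0// ltW.
  exists N.+1 => //; rewrite [leRHS]mulrC -ler_pdivrMr//; apply: le_trans (ltW hN) _.
  by rewrite ler_nat.
have n0' : 0 < n%:R :> R by rewrite ltr0n.
pose phi (k : nat) := h (k%:R / n%:R).
exists (bernstein n phi) => t /andP[t0 t1].
(* B k is L (u^2 / d + d) / 2 for the deviation u = k / n - t. *)
pose r := L / (2 * d * n%:R ^+ 2).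
pose B k := r * ((k%:R + - (n%:R * t)) ^+ 2) + L * d / 2.
have hB (k : nat) : (k <= n)%N -> `|phi k - h t| <= B k.
  move=> kn; apply: le_trans (hL _ _ _ _) _; rewrite ?t0 ?t1//.
    by rewrite divr_ge0//= ler_pdivrMr// mul1r ler_nat.
  have -> : B k = L * ((k%:R / n%:R - t) ^+ 2 / d + d) / 2.
    rewrite /B /r; field; rewrite ?gt_eqF//.
  rewrite -mulrA ler_wpM2l//.
  set u := k%:R / n%:R - t.
  rewrite -(real_normK (num_real u)); set w := `|u|.
  have w0 : 0 <= w by rewrite normr_ge0.
  rewrite ler_pdivlMr// -(ler_pM2r d0) mulrDl divfK ?gt_eqF//.
  have := sqr_ge0 (w - d); lra.
have hV : (bernstein n B).[t] <= e.
  rewrite bernstein_affine bernstein_variance subrr expr0n add0r.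
  have -> : r * (n%:R * t * (1 - t)) = (L / d / n%:R) * (t * (1 - t)) / 2.
    by rewrite /r; field; rewrite ?gt_eqF.
  have h1 : L / d / n%:R <= e by rewrite ler_pdivrMr.
  have h2 : 0 <= L / d / n%:R by rewrite !divr_ge0// ltW.
  have h3 : t * (1 - t) <= 1 by nra.
  have h4 : 0 <= t * (1 - t) by rewrite mulr_ge0// subr_ge0.
  have h5 : (L / d / n%:R) * (t * (1 - t)) <= e.
    by apply: le_trans (ler_wpM2l h2 h3) _; rewrite mulr1.
  lra.
have h1 : (bernstein n phi).[t] <= (bernstein n B).[t] + h t.
  rewrite -[X in _ <= X + _]mul1r -bernstein_affine; apply: bernstein_le => // k kn.
  by have := hB _ kn; rewrite mul1r ler_norml => /andP[_]; lra.
have h2 : - (bernstein n B).[t] + h t <= (bernstein n phi).[t].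
  rewrite -[X in X + _]mulN1r -bernstein_affine; apply: bernstein_le => // k kn.
  by have := hB _ kn; rewrite mulN1r ler_norml => /andP[]; lra.
by rewrite ler_norml; apply/andP; split; lra.
Qed.

Definition lipschitz_itv (m M : R) (g : R -> R) := exists2 L : R, 0 <= L &
  forall s t : R, m <= s <= M -> m <= t <= M -> `|g s - g t| <= L * `|s - t|.

Lemma lipschitz_approx (g : R -> R) (m M e : R) : m < M -> 0 < e -> lipschitz_itv m M g ->
  exists p : {poly R}, forall t, m <= t <= M -> `|g t - p.[t]| <= e.
Proof.
move=> mM e0 [L L0 hL]; have D0 : 0 < M - m by rewrite subr_gt0.
have [||p hp] := @bernstein_approx (fun s => g (m + (M - m) * s)) (L * (M - m)) e _ e0.
- by rewrite mulr_ge0// ltW.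
- move=> s t /andP[s0 s1] /andP[t0 t1]; apply: le_trans (hL _ _ _ _) _.
  + apply/andP; split; nra.
  + apply/andP; split; nra.
  + rewrite -mulrA ler_wpM2l//.
    have -> : m + (M - m) * s - (m + (M - m) * t) = (M - m) * (s - t) by ring.
    by rewrite normrM ger0_norm// ltW.
exists (p \Po ((M - m)^-1 *: ('X - m%:P))) => t /andP[mt tM].
rewrite horner_comp !hornerE.
have := hp ((M - m)^-1 * (t - m)).
have -> : m + (M - m) * ((M - m)^-1 * (t - m)) = t by field; rewrite gt_eqF.
apply.
by rewrite mulr_ge0 ?invr_ge0 ?subr_ge0 ?(ltW mM)//= ler_pdivrMl// mulr1 lerD2r.
Qed.

End Bernstein.

(** * Positive operators and their spectral bounds *)

Section Lipschitz.
Variable R : realType.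

Lemma invsqrt_lipschitz (m M : R) : 0 < m ->
  lipschitz_itv m M (fun t : R => t `^ (- 2^-1)).
Proof.
move=> m0; set c := Num.sqrt m.
have c0 : 0 < c by rewrite sqrtr_gt0.
exists (c * c * c)^-1; first by rewrite invr_ge0 !mulr_ge0 ?(ltW c0).
move=> s t /andP[ms sM] /andP[mt tM].
have s0 := lt_le_trans m0 ms; have t0 := lt_le_trans m0 mt.
rewrite !powRN !powR12_sqrt ?(ltW s0) ?(ltW t0)//.
have ca : c <= Num.sqrt s by rewrite ler_wsqrtr.
have cb : c <= Num.sqrt t by rewrite ler_wsqrtr.
have Es : s = Num.sqrt s ^+ 2 by rewrite sqr_sqrtr// ltW.
have Et : t = Num.sqrt t ^+ 2 by rewrite sqr_sqrtr// ltW.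
rewrite {2}Es {2}Et; move: (Num.sqrt s) (Num.sqrt t) ca cb => a b ca cb.
have a0 := lt_le_trans c0 ca; have b0 := lt_le_trans c0 cb.
have -> : a^-1 - b^-1 = - ((a - b) / (a * b)) by field; rewrite !gt_eqF.
have -> : a ^+ 2 - b ^+ 2 = (a - b) * (a + b) by ring.
rewrite normrN !normrM mulrCA ler_wpM2l// ger0_norm;
  last by rewrite invr_ge0 mulr_ge0 ?(ltW a0) ?(ltW b0).
rewrite ger0_norm ?addr_ge0 ?(ltW a0) ?(ltW b0)//.
rewrite (mulrC _ (a + b)) ler_pdivlMr ?mulr_gt0// ler_pdivrMl ?mulr_gt0//.
have h1 : c * c <= a * b by apply: ler_pM; rewrite ?(ltW c0).
have h2 : (c * c) * c <= (a * b) * (a + b).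
  by apply: ler_pM; rewrite ?mulr_ge0 ?(ltW c0)//; lra.
exact: h2.
Qed.

Lemma ln_lipschitz (m M : R) : 0 < m -> lipschitz_itv m M (@ln R).
Proof.
move=> m0; exists m^-1; first by rewrite invr_ge0 ltW.
move=> s t; wlog st : s t / s <= t.
  move=> w; case: (leP s t) => [|/ltW] h hs ht; first exact: w.
  by rewrite distrC (distrC s); exact: w.
move=> /andP[ms sM] /andP[mt tM].
have s0 := lt_le_trans m0 ms; have t0 := lt_le_trans m0 mt.
rewrite distrC (distrC s) !ger0_norm ?subr_ge0 ?ler_ln ?posrE//.
rewrite -ln_div ?posrE//.
have := @le_ln1Dx R (t / s - 1).
rewrite (addrC 1) subrK => h.
have {}h : ln (t / s) <= t / s - 1.
  by apply: h; rewrite ltrBDr addNr divr_gt0.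
apply: le_trans h _.
have -> : t / s - 1 = (t - s) / s by field; rewrite gt_eqF.
by rewrite mulrC ler_wpM2r ?subr_ge0// lef_pV2 ?posrE.
Qed.

End Lipschitz.

Section Between.
Variables (R : realType) (H : hilbertType R).
Implicit Types (x y z : H) (a b c : H -> H) (m M : R) (u : pdop H).

(** [m <= a <= M] in the Loewner order, [m] and [M] standing for scalar operators. *)
Definition op_between m M a := [/\ bounded_op a, symmetric_op a &
  forall x, m * rnorm x ^+ 2 <= rinner (a x) x <= M * rnorm x ^+ 2].

Lemma real_spectrum_between m M a t : op_between m M a -> real_spectrum a t -> m <= t <= M.
Proof.
move=> [ba sa h] st.
have [| |-> ->//] := @real_spectrum_range _ _ a m M t ba _ _ st.
  by move=> x; have /andP[] := h x.
by move=> x; have /andP[] := h x.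
Qed.

Lemma rinner_le_opnorm a x : bounded_op a -> rinner (a x) x <= opnorm a * rnorm x ^+ 2.
Proof.
move=> ba; apply: le_trans (cauchy_schwarz _ _) _.
by rewrite expr2 mulrA ler_wpM2r ?rnorm_ge0// opnorm_ub.
Qed.

(** A positive invertible operator is bounded away from 0: Cauchy-Schwarz for
    the form of [u], applied to [g x] and [x] where [g] is the inverse of [u],
    gives ||x||^4 <= <x, g x> <u x, x>. *)
Lemma pdop_op_between u : exists2 m, 0 < m & op_between m (opnorm u) u.
Proof.
have [bu pu [g [bg _ gK]]] := pdopP u; have lu := bounded_op_linear bu.
have su := posdef_symmetric lu pu.
have K0 : 0 < opnorm g + 1 by rewrite ltr_wpDl ?opnorm_ge0.
exists (opnorm g + 1)^-1; first by rewrite invr_gt0.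
split=> // x; rewrite rinner_le_opnorm// andbT ler_pdivrMl//.
have [->|x0] := eqVneq x 0; first by rewrite rnorm0 expr0n/= (linear_op0 lu) rinnerxx rnorm0
  expr0n mulr0.
have nx : 0 < rnorm x ^+ 2 by rewrite exprn_gt0// lt_neqAle rnorm_ge0 eq_sym rnorm_eq0 x0.
have := cauchy_schwarz_op (g x) x lu su (fun z => posdef_rinner_ge0 z lu pu).
rewrite gK rinnerxx expr2 => h.
have h1 : rinner x (g x) <= (opnorm g + 1) * rnorm x ^+ 2.
  rewrite rinnerC; apply: le_trans (rinner_le_opnorm _ bg) _.
  by rewrite ler_pM2r// lerDl.
rewrite -(ler_pM2r nx); apply: le_trans h _.
have := posdef_rinner_ge0 x lu pu; nra.
Qed.

Lemma op_between_fcalc m M a (f : R -> R) : m < M -> lipschitz_itv m M f -> op_between m M a ->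
  is_fcalc f a (fcalc f a).
Proof.
move=> mM fl ab; have [ba sa _] := ab; apply: fcalc_ex => // e e0.
have [p hp] := lipschitz_approx mM e0 fl.
by exists p => t /(real_spectrum_between ab); exact: hp.
Qed.

Lemma op_between_widen m M m' M' a : m' <= m -> M <= M' -> op_between m M a -> op_between m' M' a.
Proof.
move=> mm MM [ba sa h]; split=> // x; have /andP[h1 h2] := h x.
have x0 := exprn_ge0 2 (rnorm_ge0 x); apply/andP; split.
  by apply: le_trans h1; rewrite ler_wpM2r.
by apply: le_trans h2 _; rewrite ler_wpM2r.
Qed.

(** The least spectral value of [a]. Expressed through norms, it is visibly
    Lipschitz in [a], and [opnorm_op_horner_attained] places it in the
    spectrum. *)
Definition bottom a := opnorm a - opnorm (fun x => (opnorm a)%:C *: x - a x).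

Lemma opnorm_real_spectrum m M a (e : H) : e != 0 -> 0 <= m -> op_between m M a ->
  real_spectrum a (opnorm a).
Proof.
move=> e0 m0 ab; have [ba sa _] := ab.
have [t st] := opnorm_op_horner_attained ba sa 'X e0.
have /andP[mt _] := real_spectrum_between ab st.
have -> : op_horner 'X a = a by apply/funext => x; rewrite op_hornerX.
by rewrite hornerX ger0_norm ?(le_trans m0 mt)// => <-.
Qed.

Lemma op_between_opnorm m M a : op_between m M a -> op_between m (opnorm a) a.
Proof.
by move=> [ba sa h]; split=> // x; have /andP[-> _] := h x; rewrite rinner_le_opnorm.
Qed.

Lemma bottom_real_spectrum m M a (e : H) : e != 0 -> op_between m M a ->
  real_spectrum a (bottom a).
Proof.
move=> e0 ab; have [ba sa _] := ab.
have [t st] := opnorm_op_horner_attained ba sa ((opnorm a)%:P - 'X) e0.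
have /andP[_ tN] := real_spectrum_between (op_between_opnorm ab) st.
have -> : op_horner ((opnorm a)%:P - 'X) a = fun x => (opnorm a)%:C *: x - a x.
  by apply/funext => x; rewrite op_hornerB op_hornerC op_hornerX.
rewrite !hornerE ger0_norm ?subr_ge0// /bottom => <-.
by rewrite opprB addrC subrK.
Qed.

(** The form of ||a|| - a is at most its norm, which is ||a|| - bottom a. *)
Lemma op_between_bottom m M a : op_between m M a -> op_between (bottom a) (opnorm a) a.
Proof.
move=> ab; have [ba sa h] := op_between_opnorm ab; split=> // x.
have /andP[_ ->] := h x; rewrite andbT mulrBl lerBlDr -lerBlDl.
have := @rinner_le_opnorm (fun x =>
  (opnorm a)%:C *: x - a x) x (bounded_sub (bounded_scalar _ _) ba).
by rewrite rinnerDl rinnerNl rinnerZl rinnerxx.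
Qed.

Section Invsqrt.
Variables (u : pdop H) (mu Mu : R) (mu0 : 0 < mu) (ub : op_between mu Mu u).
Let s := fcalc (fun t : R => t `^ (- 2^-1)) u.

Lemma invsqrt_fcalc : is_fcalc (fun t : R => t `^ (- 2^-1)) u s.
Proof.
have ub' : op_between mu (Num.max Mu (mu + 1)) u.
  by apply: op_between_widen ub; rewrite ?lexx// le_max lexx.
apply: (op_between_fcalc _ _ ub').
  by rewrite lt_max; apply/orP; right; rewrite ltrDl.
exact: invsqrt_lipschitz.
Qed.

Lemma invsqrt_bounded : bounded_op s.
Proof. by case: invsqrt_fcalc. Qed.

Lemma invsqrt_symmetric : symmetric_op s.
Proof. by have [bu su _] := ub; exact: is_fcalc_symmetric invsqrt_fcalc. Qed.

(** The function t^(-1/2) t t^(-1/2) is 1 on the spectrum. *)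
Lemma invsqrtK x : s (u (s x)) = x.
Proof.
have [bu su _] := ub.
have h1 := is_fcalc_mul bu invsqrt_fcalc (is_fcalc_mul bu (is_fcalc_id bu) invsqrt_fcalc).
have h2 := is_fcalc_cst bu 1.
have /(congr1 (@^~ x)) : (fun x => s (u (s x))) = (fun x => 1%:C *: x).
  apply: (is_fcalc_uniq bu su h1 h2) => t /(real_spectrum_between ub)/andP[mt _].
  have t0 := lt_le_trans mu0 mt.
  rewrite mulrCA -powRD; last by rewrite (gt_eqF t0) implybT.
  rewrite -[X in X * _](@powRr1 _ t) ?(ltW t0)// -powRD; last by rewrite (gt_eqF t0) implybT.
  by rewrite (_ : 1 + _ = 0) ?powRr0//; lra.
by rewrite /= scale1r.
Qed.

(** With w = u^(-1/2) x, the form of the congruence at x is that of [a] at w,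
    while ||x||^2 = <u w, w> is comparable to ||w||^2. *)
Lemma invsqrt_congr_between m M a : 0 <= m -> 0 < Mu -> op_between m M a ->
  op_between (m / Mu) (M / mu) (invsqrt_congr u a).
Proof.
move=> m0 Mu0 [ba sa h]; have [bu su hu] := ub.
have ss := invsqrt_symmetric; have bs := invsqrt_bounded.
split.
- exact: (bounded_comp (bounded_comp bs ba) bs).
- by move=> x y; rewrite /invsqrt_congr /= ss sa ss.
move=> x; rewrite /invsqrt_congr /= ss.
have /andP[h1 h2] := h (s x); have /andP[h3 h4] := hu (s x).
have E : rinner (u (s x)) (s x) = rnorm x ^+ 2 by rewrite -ss invsqrtK rinnerxx.
rewrite E in h3 h4; have n0 := exprn_ge0 2 (rnorm_ge0 (s x)).
apply/andP; split.
  apply: le_trans h1; rewrite -mulrA ler_wpM2l// ler_pdivrMl//.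
have M0 : 0 <= M \/ rnorm (s x) ^+ 2 = 0.
  have [->|?] := eqVneq (rnorm (s x) ^+ 2) 0; [by right|left].
  have n1 : 0 < rnorm (s x) ^+ 2 by rewrite lt_neqAle eq_sym n0 andbT.
  by have := le_trans h1 h2; rewrite ler_pM2r//; exact: le_trans.
apply: le_trans h2 _; case: M0 => [M0|n1].
  by rewrite -mulrA ler_wpM2l// ler_pdivlMl.
have : rnorm x ^+ 2 = 0 by apply/eqP; rewrite eq_le exprn_ge0 ?rnorm_ge0// andbT; move: h4;
  rewrite n1 mulr0.
by move=> ->; rewrite n1 !mulr0.
Qed.

End Invsqrt.

Lemma opnorm_fcalc_le_mono (f : R -> R) m M a B : 0 < m -> 0 <= B ->
  (forall s t, 0 < s -> s <= t -> f s <= f t) -> op_between m M a ->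
  - B <= f m -> f M <= B -> opnorm (fcalc f a) <= B.
Proof.
move=> m0 B0 fm ab h1 h2; have [ba sa _] := ab; apply: opnorm_fcalc_le => // t st.
have /andP[mt tM] := real_spectrum_between ab st.
rewrite ler_norml (le_trans h1) ?fm//= (le_trans _ h2)// fm//.
exact: lt_le_trans mt.
Qed.

(** The logarithm of c = x^(-1/2) z x^(-1/2) has norm less than [e], hence the
    spectrum of c lies between exp(-e) and exp(e); undoing the congruence
    compares the form of [z] with that of [x]. *)
Lemma thompson_between (x z : pdop H) (e mx Mx : R) (v : H) : v != 0 -> thompson x z < e ->
  0 < mx -> op_between mx Mx x -> op_between (expR (- e) * mx) (expR e * Mx) z.
Proof.
move=> v0 hxz mx0 xb; have [mz mz0 zb] := pdop_op_between z.
have ss := invsqrt_symmetric mx0 xb; have sK := invsqrtK mx0 xb.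
move: hxz; rewrite /thompson; set c := invsqrt_congr x z => hxz.
have nv : 0 < rnorm v ^+ 2 by rewrite exprn_gt0// lt_neqAle rnorm_ge0 eq_sym rnorm_eq0 v0.
have pos m M a : 0 < m -> op_between m M a -> 0 < M.
  move=> m0 [_ _ /(_ v) /andP[h1 h2]]; have := le_trans h1 h2.
  by rewrite ler_pM2r//; exact: lt_le_trans.
have Mx0 := pos _ _ _ mx0 xb.
have cb : op_between (mz / Mx) (opnorm c) c.
  by apply: op_between_opnorm; exact: (invsqrt_congr_between mx0 xb (ltW mz0) Mx0 zb).
have m0 : 0 < mz / Mx by rewrite divr_gt0.
have cb' : op_between (mz / Mx) (opnorm c + 1 + mz / Mx) c.
  by apply: op_between_widen cb => //; rewrite -addrA lerDl addr_ge0// ltW.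
have lnc : is_fcalc (@ln R) c (fcalc (@ln R) c).
  apply: (op_between_fcalc _ _ cb'); last exact: ln_lipschitz.
  by rewrite ltrDr ltr_wpDl// (ltW (pos _ _ _ m0 cb)).
have [bc sc _] := cb.
have sN := opnorm_real_spectrum v0 (ltW m0) cb.
have sb := bottom_real_spectrum v0 cb.
have N0 := pos _ _ _ m0 cb.
have b0 : 0 < bottom c by have /andP[+ _] := real_spectrum_between cb sb; exact: lt_le_trans.
have hN : opnorm c <= expR e.
  rewrite -[leLHS]lnK ?posrE// ler_expR; apply: le_trans (ler_norm _) _.
  exact: le_trans (is_fcalc_ge bc lnc sN) (ltW hxz).
have hb : expR (- e) <= bottom c.
  rewrite -[leRHS]lnK ?posrE// ler_expR lerNl; apply: le_trans (ler_norm _) _.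
  by rewrite normrN; exact: le_trans (is_fcalc_ge bc lnc sb) (ltW hxz).
have [bx sx hx] := xb; have [bz sz _] := zb; split=> // w.
set s := fcalc _ _ in ss sK.
have := op_between_widen hb hN (op_between_bottom cb) => -[_ _ /(_ (x (s w)))].
rewrite /c /invsqrt_congr /= -/s ss sK.
have -> : rnorm (x (s w)) ^+ 2 = rinner (x w) w.
  by rewrite -rinnerxx -{1}(sK (x (s w))) ss sK.
have /andP[h1 h2] := hx w.
move=> /andP[h3 h4]; apply/andP; split.
  by apply: le_trans h3; rewrite -mulrA ler_pM2l ?expR_gt0.
by apply: le_trans h4 _; rewrite -mulrA ler_pM2l ?expR_gt0.
Qed.

End Between.

(** * The Hilbert space of dimension two *)

Section PlaneNorm.
Variable R : realType.

(** Pairs of complex numbers with the Euclidean norm; the norm of the product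
    type would be the supremum norm, which no inner product induces. *)
Definition plane : Type := (R[i]^o * R[i]^o)%type.

HB.instance Definition _ := GRing.Lmodule.copy plane (R[i]^o * R[i]^o)%type.

Implicit Types (v w : plane).

Definition sqnorm v : R := complex.Re v.1 ^+ 2 + complex.Im v.1 ^+ 2 +
  (complex.Re v.2 ^+ 2 + complex.Im v.2 ^+ 2).

Definition plane_norm v : R[i] := (Num.sqrt (sqnorm v))%:C.

Lemma sqnorm_ge0 v : 0 <= sqnorm v.
Proof. by rewrite !addr_ge0 ?sqr_ge0. Qed.

Lemma plane_normD v w : plane_norm (v + w) <= plane_norm v + plane_norm w.
Proof.
rewrite -rmorphD lecR /=.
case: v w => [[a b] [c d]] [[a' b'] [c' d']].
rewrite -(@ler_pXn2r _ 2)// ?nnegrE ?addr_ge0 ?sqrtr_ge0//.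
rewrite sqrrD !sqr_sqrtr ?sqnorm_ge0//.
rewrite -mulr_natl -sqrtrM ?sqnorm_ge0// /sqnorm /=.
set N := Num.sqrt _.
have h : a * a' + b * b' + (c * c' + d * d') <= N.
  apply: le_trans (ler_norm _) _; rewrite -sqrtr_sqr ler_wsqrtr// -subr_ge0.
  have -> : (a ^+ 2 + b ^+ 2 + (c ^+ 2 + d ^+ 2)) * (a' ^+ 2 + b' ^+ 2 + (c' ^+ 2 + d' ^+ 2)) -
     (a * a' + b * b' + (c * c' + d * d')) ^+ 2 =
     (a * b' - b * a') ^+ 2 + (a * c' - c * a') ^+ 2 + (a * d' - d * a') ^+ 2 +
     (b * c' - c * b') ^+ 2 + (b * d' - d * b') ^+ 2 + (c * d' - d * c') ^+ 2 by ring.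
  by rewrite !addr_ge0 ?sqr_ge0.
lra.
Qed.

Lemma plane_normZ (l : R[i]) v : plane_norm (l *: v) = `|l| * plane_norm v.
Proof.
rewrite normc_def /plane_norm -rmorphM -sqrtrM ?addr_ge0 ?sqr_ge0//.
case: l v => [x y] [[a b] [c d]]; rewrite /sqnorm /=; congr (Num.sqrt _)%:C; ring.
Qed.

Lemma plane_norm0_eq0 v : plane_norm v = 0 -> v = 0.
Proof.
move=> /complexI/eqP; rewrite sqrtr_eq0 /sqnorm.
case: v => [[a b] [c d]] /= h.
have := sqr_ge0 a; have := sqr_ge0 b; have := sqr_ge0 c; have := sqr_ge0 d => h1 h2 h3 h4.
have z (t : R) : t ^+ 2 = 0 -> t = 0 by move=> /eqP; rewrite sqrf_eq0 => /eqP.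
have -> : a = 0 by apply: z; lra.
have -> : b = 0 by apply: z; lra.
have -> : c = 0 by apply: z; lra.
by have -> : d = 0 by apply: z; lra.
Qed.

HB.instance Definition _ := Lmodule_isNormed.Build R[i] plane
  plane_normD plane_normZ plane_norm0_eq0.

Lemma plane_normE v : `|v| = (Num.sqrt (sqnorm v))%:C. Proof. by []. Qed.

Lemma sqnorm_le v (e : R) : 0 <= e -> (`|v| <= e%:C) = (sqnorm v <= e ^+ 2).
Proof.
move=> e0; rewrite plane_normE lecR -{1}(ger0_norm e0) -sqrtr_sqr ler_sqrt//.
exact: sqr_ge0.
Qed.

(** A coordinate whose increments are bounded by the norm carries Cauchy
    filters of the plane to convergent filters of reals. *)
Lemma coordinate_cvg (F : set_system plane) (phi : plane -> R) : ProperFilter F -> cauchy F ->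
  (forall v w, (phi v - phi w) ^+ 2 <= sqnorm (v - w)) ->
  exists l : R, forall e : R, 0 < e -> F [set v | (phi v - l) ^+ 2 <= e ^+ 2].
Proof.
move=> FF cF hphi.
have : cvg (phi @ F).
  apply: cauchy_cvg; apply: cauchy_exP => e e0.
  have /cauchy_ballP/(_ (e / 2)%:C) := cF;
    rewrite ltcR divr_gt0// => /(_ isT) [[A B] [/= FA FB] hAB].
  have [w [Aw Bw]] := filter_ex (filterI FA FB).
  exists (phi w); apply: filterS FB => v Bv; rewrite /ball /=.
  have := hAB (w, v) (conj Aw Bv); rewrite -ball_normE /= => /ltW.
  rewrite sqnorm_le ?divr_ge0 ?(ltW e0)// => h.
  have := le_trans (hphi w v) h => {}h.
  have : `|phi w - phi v| <= e / 2.
    by rewrite -(@ler_pXn2r _ 2)// ?nnegrE ?divr_ge0 ?(ltW e0)// real_normK ?num_real.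
  by move=> h'; apply: le_lt_trans h' _; lra.
move=> /cvg_ex[l hl]; exists l => e e0.
have /cvgrPdist_le/(_ e e0) := hl; apply: filterS => v /= h.
rewrite -(real_normK (num_real (phi v - l))) lerXn2r ?nnegrE ?(ltW e0)//.
by rewrite distrC.
Qed.

Lemma plane_complete (F : set_system plane) : ProperFilter F -> cauchy F -> cvg F.
Proof.
move=> FF cF.
have [|a ha] := @coordinate_cvg F (fun v => complex.Re v.1) FF cF.
  move=> [[? ?] [? ?]] [[? ?] [? ?]]; rewrite /sqnorm /= -addrA lerDl.
  by rewrite !addr_ge0 ?sqr_ge0.
have [|b hb] := @coordinate_cvg F (fun v => complex.Im v.1) FF cF.
  move=> [[? ?] [? ?]] [[? ?] [? ?]]; rewrite /sqnorm /= addrAC lerDr.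
  by rewrite !addr_ge0 ?sqr_ge0.
have [|c hc] := @coordinate_cvg F (fun v => complex.Re v.2) FF cF.
  move=> [[? ?] [? ?]] [[? ?] [? ?]]; rewrite /sqnorm /= addrCA lerDl.
  by rewrite !addr_ge0 ?sqr_ge0.
have [|d hd] := @coordinate_cvg F (fun v => complex.Im v.2) FF cF.
  move=> [[? ?] [? ?]] [[? ?] [? ?]]; rewrite /sqnorm /= addrA lerDr.
  by rewrite !addr_ge0 ?sqr_ge0.
apply/cvg_ex; exists ((a +i* b, c +i* d) : plane).
apply/cvgrPdist_le => e e0.
have e0' : 0 < complex.Re e by move: e0; rewrite ltcE => /andP[].
have -> : e = (complex.Re e)%:C by rewrite RRe_real// gtr0_real.
move: (complex.Re e) e0' => {e0}e e0.
have e2 : 0 < e / 2 by rewrite divr_gt0.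
apply: (filterS _ (filterI (filterI (ha _ e2) (hb _ e2)) (filterI (hc _ e2) (hd _ e2)))).
move=> v [[h1 h2] [h3 h4]] /=.
rewrite distrC sqnorm_le ?(ltW e0)//.
by case: v h1 h2 h3 h4 => [[x y] [z t]] /=; rewrite /sqnorm /=; lra.
Qed.

HB.instance Definition _ := Uniform_isComplete.Build plane plane_complete.

Definition plane_dot v w : R[i] := v.1 * Num.conj w.1 + v.2 * Num.conj w.2.

Lemma plane_dot_bilinear : bilinear_for
  (GRing.Scale.Law.clone _ _ *%R _) (GRing.Scale.Law.clone _ _ (Num.conj \; *%R) _) plane_dot.
Proof.
split=> [u a x y|u a x y]; rewrite /plane_dot /=.
- by rewrite !mulrDl -!mulrA mulrDr addrACA.
- by rewrite !rmorphD !rmorphM /= !mulrDr addrACA !(mulrCA _ (Num.conj a)).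
Qed.

HB.instance Definition _ := bilinear_isBilinear.Build R[i] plane plane R[i] _ _ plane_dot
  plane_dot_bilinear.

Lemma plane_dot_hermitian v w : plane_dot v w = (-1) ^+ false * Num.conj (plane_dot w v).
Proof.
by rewrite /plane_dot expr0 mul1r rmorphD !rmorphM /= !conjCK (mulrC v.1) (mulrC v.2).
Qed.

HB.instance Definition _ := isHermitianSesquilinear.Build R[i] plane false (@Num.conj R[i])
  plane_dot plane_dot_hermitian.

Lemma plane_dot_norm v : plane_dot v v = `|v| ^+ 2.
Proof.
rewrite plane_normE -rmorphXn /= sqr_sqrtr ?sqnorm_ge0// /plane_dot -!normCK.
by rewrite !normc_def -!rmorphXn /= !sqr_sqrtr ?addr_ge0 ?sqr_ge0// -rmorphD.
Qed.

Lemma plane_dot_gt0 v : v != 0 -> 0 < plane_dot v v.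
Proof. by move=> v0; rewrite plane_dot_norm exprn_gt0// normr_gt0. Qed.

HB.instance Definition _ := isDotProduct.Build R[i] plane plane_dot plane_dot_gt0.

HB.instance Definition _ := CompleteNormedModule_isHilbert.Build R plane plane_dot_norm.

End PlaneNorm.

(** * Operators with two eigenvalues *)

Section TwoLevel.
Variables (R : realType) (H : hilbertType R).
Implicit Types (x y : H) (P Q : H -> H) (s t u v r : R).

Definition projection P := [/\ bounded_op P, symmetric_op P & forall x, P (P x) = P x].

(** The operator with eigenvalue [s] on the range of the projection [P] and [t]
    on its kernel. Inverses and functions of such operators are explicit,
    whatever the function. *)
Definition two_level P s t : H -> H := fun x => s%:C *: P x + t%:C *: (x - P x).

Lemma two_level_bounded P s t : projection P -> bounded_op (two_level P s t).
Proof.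
move=> [bP _ _]; apply: bounded_add (bounded_scale _ bP) _.
by apply: (@bounded_scale _ _ (fun x => x - P x)); exact: bounded_sub (bounded_id H) bP.
Qed.

Lemma two_level_symmetric P s t : projection P -> symmetric_op (two_level P s t).
Proof.
move=> [_ sP _] x y.
by rewrite /two_level !(rinnerDl, rinnerDr, rinnerNl, rinnerNr, rinnerZl, rinnerZr) sP.
Qed.

Lemma two_level_comp P s t s' t' x : projection P ->
  two_level P s t (two_level P s' t' x) = two_level P (s * s') (t * t') x.
Proof.
move=> [/bounded_op_linear lP _ PP]; rewrite /two_level.
rewrite (linear_opD _ _ lP) !(linear_opZ _ _ lP) (linear_opB _ _ lP) !PP subrr scaler0 addr0.
by rewrite addrAC subrr add0r !scalerA !rmorphM.
Qed.

Lemma two_level_scalar P s x : two_level P s s x = s%:C *: x.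
Proof. by rewrite /two_level -scalerDr addrC subrK. Qed.

Lemma two_level_form P s t x : projection P ->
  rinner (two_level P s t x) x = s * rnorm (P x) ^+ 2 + t * rnorm (x - P x) ^+ 2.
Proof.
move=> [_ sP PP]; rewrite /two_level rinnerDl !rinnerZl; congr (s * _ + t * _).
  by rewrite -rinnerxx -sP PP.
have e1 : rinner (P x) x = rinner x (P x) := sP x x.
have e2 : rinner (P x) (P x) = rinner x (P x) by rewrite sP PP.
by rewrite -rinnerxx !(rinnerDl, rinnerDr, rinnerNl, rinnerNr) e1 e2; lra.
Qed.

Lemma two_level_invertible P s t : projection P -> s != 0 -> t != 0 ->
  invertible_op (two_level P s t).
Proof.
move=> pP s0 t0; exists (two_level P s^-1 t^-1); split; first exact: two_level_bounded.
  by move=> x; rewrite two_level_comp// !mulVf// two_level_scalar scale1r.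
by move=> x; rewrite two_level_comp// !mulfV// two_level_scalar scale1r.
Qed.

Lemma real_spectrum_two_level P s t r : projection P -> real_spectrum (two_level P s t) r ->
  r = s \/ r = t.
Proof.
move=> pP st; apply: contrapT => /not_orP[rs rt]; apply: st.
have -> : (fun x => two_level P s t x - r%:C *: x) = two_level P (s - r) (t - r).
  apply/funext => x; rewrite -(two_level_scalar P) /two_level opprD addrACA -!scalerBl.
  by rewrite !rmorphB.
by apply: two_level_invertible => //; rewrite subr_eq0 eq_sym; apply/eqP.
Qed.

(** On the spectrum, any function agrees with the affine polynomial that
    interpolates it at the two eigenvalues. *)
Lemma fcalc_two_level f P s t : projection P ->
  fcalc f (two_level P s t) = two_level P (f s) (f t).
Proof.
move=> pP; have bl := two_level_bounded s t pP; have sl := two_level_symmetric s t pP.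
apply: fcalcE => //.
pose k := if s == t then 0 else (f t - f s) / (t - s).
have kE : k * t + (f s - k * s) = f t.
  rewrite /k; case: eqVneq => [->|st]; first by ring.
  by field; rewrite subr_eq0 eq_sym.
pose p := k *: 'X + (f s - k * s)%:P.
have pE r : p.[r] = k * r + (f s - k * s) by rewrite !hornerE.
have -> : two_level P (f s) (f t) = op_horner p (two_level P s t).
  apply/funext => x; rewrite /p -mul_polyC op_hornerD op_hornerM//;
    last exact: bounded_op_linear bl.
  rewrite !op_hornerC op_hornerX -(two_level_scalar P) -(two_level_scalar P) two_level_comp//.
  rewrite /two_level addrACA -!scalerDl -!rmorphD; congr (_%:C *: _ + _%:C *: _).
    by ring.
  by rewrite kE.
apply: (@fcalc_eq_on _ _ _ _ (fun r => p.[r])); first exact: is_fcalc_horner.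
by move=> r /(real_spectrum_two_level pP)[]->; rewrite pE// addrC subrK.
Qed.

Lemma two_level_pd P s t : projection P -> 0 < s -> 0 < t -> pd_cone (two_level P s t).
Proof.
move=> pP s0 t0; split; [exact: two_level_bounded| |by apply: two_level_invertible;
  rewrite ?gt_eqF].
move=> x x0; rewrite (symmetric_inner _ (bounded_op_linear (two_level_bounded s t pP))
  (two_level_symmetric s t pP)) ltcR.
rewrite two_level_form//.
have [Px|Px] := eqVneq (P x) 0.
  rewrite Px rnorm0 expr0n mulr0 add0r subr0 mulr_gt0// exprn_gt0//.
  by rewrite lt_neqAle rnorm_ge0 eq_sym rnorm_eq0 x0.
rewrite ltr_pwDl//; last by rewrite mulr_ge0 ?(ltW t0)// exprn_ge0 ?rnorm_ge0.
by rewrite mulr_gt0// exprn_gt0// lt_neqAle rnorm_ge0 eq_sym rnorm_eq0 Px.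
Qed.

Definition form_le (a b : H -> H) := forall x, rinner (a x) x <= rinner (b x) x.

Lemma loewner_leP (a b : H -> H) : bounded_op a -> bounded_op b -> symmetric_op a ->
  symmetric_op b ->
  loewner_le a b <-> form_le a b.
Proof.
move=> /bounded_op_linear la /bounded_op_linear lb sa sb.
by split=> h x; have := h x; rewrite (symmetric_inner _ la sa) (symmetric_inner _ lb sb) lecR.
Qed.

(** Inversion reverses the order: Cauchy-Schwarz for the form of the smaller
    operator [two_level P s t]. *)
Lemma two_level_inv_antitone P Q s t u v : projection P -> projection Q ->
  0 < s -> 0 < t -> 0 < u -> 0 < v ->
  form_le (two_level P s t) (two_level Q u v) ->
    form_le (two_level Q u^-1 v^-1) (two_level P s^-1 t^-1).
Proof.
move=> pP pQ s0 t0 u0 v0 h x.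
have pos P' s' t' y : projection P' -> 0 < s' -> 0 < t' -> 0 <= rinner (two_level P' s' t' y) y.
  by move=> pP' s'0 t'0; rewrite two_level_form// addr_ge0// mulr_ge0 ?exprn_ge0 ?rnorm_ge0 ?ltW.
have sA := two_level_symmetric s t pP.
set a := rinner _ x; set b := rinner _ x.
have b0 : 0 <= b by apply: pos => //; rewrite invr_gt0.
have a0 : 0 <= a by apply: pos => //; rewrite invr_gt0.
have AA' : two_level P s t (two_level P s^-1 t^-1 x) = x.
  by rewrite two_level_comp// !mulfV ?gt_eqF// two_level_scalar scale1r.
have BB' : two_level Q u v (two_level Q u^-1 v^-1 x) = x.
  by rewrite two_level_comp// !mulfV ?gt_eqF// two_level_scalar scale1r.
have := cauchy_schwarz_op (two_level Q u^-1 v^-1 x) (two_level P s^-1 t^-1 x)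
  (bounded_op_linear (two_level_bounded s t pP)) sA
  (fun z => pos P s t z pP s0 t0).
rewrite {1}sA AA' -/a (rinnerC x) -/b => h1.
have := h (two_level Q u^-1 v^-1 x); rewrite BB' (rinnerC x) -/a => h2.
have h3 : a ^+ 2 <= a * b by apply: le_trans h1 _; rewrite ler_wpM2r.
nra.
Qed.

(** The part of operator monotonicity that concerns operators with two
    eigenvalues. It is stable under f(t) -> -f(1/t), see [two_level_flip]. *)
Definition two_level_monotone (f : R -> R) := forall P Q s t u v, projection P -> projection Q ->
  0 < s -> 0 < t -> 0 < u -> 0 < v ->
  form_le (two_level P s t) (two_level Q u v) ->
    form_le (two_level P (f s) (f t)) (two_level Q (f u) (f v)).

Lemma operator_monotone_two_level f : operator_monotone f -> two_level_monotone f.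
Proof.
move=> hf P Q s t u v pP pQ s0 t0 u0 v0 h.
pose A := PdOp (two_level_pd pP s0 t0); pose B := PdOp (two_level_pd pQ u0 v0).
have EA : fcalc f A = two_level P (f s) (f t) := fcalc_two_level f s t pP.
have EB : fcalc f B = two_level Q (f u) (f v) := fcalc_two_level f u v pQ.
have h1 : loewner_le A B.
  by apply/loewner_leP => //; [exact: two_level_bounded|exact: two_level_bounded|exact:
    two_level_symmetric|exact: two_level_symmetric].
have := hf _ A B h1; rewrite EA EB.
by move/loewner_leP; apply; [exact: two_level_bounded|exact: two_level_bounded|exact:
  two_level_symmetric|exact: two_level_symmetric].
Qed.

Lemma two_level_flip f : two_level_monotone f -> two_level_monotone (fun t => - f t^-1).
Proof.
move=> hf P Q s t u v pP pQ s0 t0 u0 v0 h x.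
have := hf Q P u^-1 v^-1 s^-1 t^-1 pQ pP; rewrite !invr_gt0 => /(_ u0 v0 s0 t0).
move=> /(_ (two_level_inv_antitone pP pQ s0 t0 u0 v0 h) x).
rewrite !two_level_form//; lra.
Qed.

End TwoLevel.
Arguments two_level_monotone {R} H f.

(** * Operator monotone functions are concave *)

Section Concavity.
Variable R : realType.
Implicit Types (f g : R -> R) (P Q : plane R -> plane R).

Lemma plane_linE (k x y z t : R[i]) :
  k *: ((x, y) : plane R) + (z, t) = (k * x + z, k * y + t) :> plane R.
Proof. by []. Qed.

Lemma plane_rip (a b c d a' b' c' d' : R) :
  rinner ((a +i* b, c +i* d) : plane R)
    (a' +i* b', c' +i* d') = a * a' + b * b' + (c * c' + d * d').
Proof. by rewrite /rinner /=; ring. Qed.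

Definition line_proj (c d : R) : plane R -> plane R :=
  fun x => ((c%:C * (c%:C * x.1 + d%:C * x.2)), (d%:C * (c%:C * x.1 + d%:C * x.2))).

Lemma line_projP (c d : R) : c ^+ 2 + d ^+ 2 = 1 -> projection (line_proj c d).
Proof.
move=> cd; have l : linear (line_proj c d).
  move=> k [x y] [z t]; rewrite plane_linE /line_proj /= plane_linE.
  by congr (_, _); ring.
have s : symmetric_op (line_proj c d).
  move=> [[x1 x2] [x3 x4]] [[y1 y2] [y3 y4]].
  by rewrite plane_rip plane_rip /=; ring.
have i x : line_proj c d (line_proj c d x) = line_proj c d x.
  have cdC : c%:C ^+ 2 + d%:C ^+ 2 = 1 by rewrite -!rmorphXn -rmorphD cd.
  case: x => x y; rewrite /line_proj /=.
  set w := c%:C * x + d%:C * y.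
  have -> : c%:C * (c%:C * w) + d%:C * (d%:C * w) = (c%:C ^+ 2 + d%:C ^+ 2) * w by ring.
  by rewrite cdC mul1r.
split=> //; apply: (@bounded_op_intro _ _ _ 1) => // x; rewrite mul1r.
have e : rinner (line_proj c d x) (line_proj c d x) = rinner (line_proj c d x) x.
  by rewrite s i rinnerC.
have := cauchy_schwarz (line_proj c d x) x; rewrite -e rinnerxx expr2.
have [->|p0] := eqVneq (rnorm (line_proj c d x)) 0; first by rewrite rnorm_ge0.
by rewrite ler_pM2l// lt_neqAle rnorm_ge0 eq_sym p0.
Qed.

Lemma two_level_rinner P s t (x : plane R) :
  rinner (two_level P s t x) x = s * rinner (P x) x + t * (rinner x x - rinner (P x) x).
Proof. by rewrite /two_level rinnerDl !rinnerZl rinnerDl rinnerNl. Qed.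

Lemma line_proj_form (c d a b a' b' : R) (x : plane R := (a +i* b, a' +i* b')) :
  rinner (line_proj c d x) x = (c * a + d * a') ^+ 2 + (c * b + d * b') ^+ 2.
Proof. by rewrite /rinner /line_proj /=; ring. Qed.

(** Let A have eigenvalues [s] and [t], with [l] the squared length of the first
    basis vector projected to the eigenspace of [s]. The diagonal entry of A at
    that vector is the mean l s + (1 - l) t, and A is below the diagonal matrix
    with entries mean + e and N for N large. Comparing the first diagonal
    entries of f(A) and of f of the diagonal matrix gives the inequality. *)
Lemma two_level_mean g (l s t e : R) : two_level_monotone (plane R) g -> 0 <= l <= 1 ->
  0 < s -> 0 < t -> 0 < e -> l * g s + (1 - l) * g t <= g (l * s + (1 - l) * t + e).
Proof.
move=> hg /andP[l0 l1] s0 t0 e0.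
pose c := Num.sqrt l; pose d := Num.sqrt (1 - l).
have c2 : c ^+ 2 = l by rewrite sqr_sqrtr.
have d2 : d ^+ 2 = 1 - l by rewrite sqr_sqrtr// subr_ge0.
have pP : projection (line_proj c d) by apply: line_projP; rewrite c2 d2; ring.
have pQ : projection (line_proj 1 0) by apply: line_projP; ring.
pose b := c * d * (s - t); pose gam := d ^+ 2 * s + c ^+ 2 * t.
(* b and gam are the other entries of A; this N makes the difference form the
   perfect square (e x - b y)^2 / e. *)
set u := _ + e; pose N := gam + b ^+ 2 / e.
have u0 : 0 < u by rewrite /u; nra.
have N0 : 0 < N.
  rewrite ltr_pwDl// ?divr_ge0 ?sqr_ge0 ?(ltW e0)// /gam c2 d2; nra.
have h : form_le (two_level (line_proj c d) s t) (two_level (line_proj 1 0) u N).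
  move=> [[x1 x2] [x3 x4]]; rewrite !two_level_rinner !line_proj_form plane_rip -subr_ge0.
  set rhs := (X in 0 <= X).
  have -> : rhs = ((e * x1 - b * x3) ^+ 2 + (e * x2 - b * x4) ^+ 2) / e
      + t * (c ^+ 2 + d ^+ 2 - 1) * (x3 ^+ 2 + x4 ^+ 2).
    rewrite /rhs /N /u /gam /b -c2; field; rewrite gt_eqF//.
  by rewrite c2 d2 (addrC l) subrK subrr mulr0 mul0r addr0 divr_ge0 ?addr_ge0 ?sqr_ge0// ltW.
have := hg _ _ _ _ _ _ pP pQ s0 t0 u0 N0 h (1 +i* 0, 0 +i* 0).
rewrite !two_level_rinner !line_proj_form plane_rip.
rewrite !(mulr0, mulr1, addr0, expr0n, mul0r, expr1n) /= !(addr0, subrr, mulr0, mulr1) c2.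
by rewrite (mulrC l) (mulrC (1 - l)).
Qed.

(** Monotonicity and concavity on the positive half-line, the latter as the
    inequality at [s] between the chord values at [r] and [t], without
    denominators. *)
Definition mono_concave g := (forall s t : R, 0 < s -> s <= t -> g s <= g t) /\
  (forall r s t : R, 0 < r -> r < s -> s < t -> (t - s) * g r + (s - r) * g t <= (t - r) * g s).

(** The slack [d] in [two_level_mean] can be absorbed by moving the weight
    instead of the point: choose the weight so that mean + d is exactly [s],
    and let [d] tend to 0. In this way no continuity of [g] is presupposed. *)
Lemma two_level_mono_concave g : two_level_monotone (plane R) g -> mono_concave g.
Proof.
move=> hg; split.
  move=> s t s0 st; have t0 := lt_le_trans s0 st.
  have pQ : projection (line_proj 1 0) by apply: line_projP; ring.
  have := hg _ _ _ _ _ _ pQ pQ s0 s0 t0 t0 _ (1 +i* 0, 0 +i* 0).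
  rewrite !two_level_scalar !rinnerZl plane_rip.
  rewrite !(mulr0, mulr1, addr0, expr0n, mul0r, expr1n); apply=> x.
  by rewrite !two_level_scalar !rinnerZl ler_wpM2r// rinnerxx exprn_ge0 ?rnorm_ge0.
move=> r s t r0 rs st; have t0 : 0 < t by lra.
apply/ler_addgt0Pr => e e0.
have gK : 0 < `|g t - g r| + 1 by rewrite ltr_wpDl.
(* d is small enough for the weight l below to lie in [0, 1]. *)
pose d := Num.min ((s - r) / 2) (e / (`|g t - g r| + 1)).
have d0 : 0 < d by rewrite lt_min !divr_gt0// subr_gt0.
have dsr : d <= (s - r) / 2 by rewrite ge_min lexx.
have de : d * (g t - g r) <= e.
  apply: (@le_trans _ _ (d * (`|g t - g r| + 1))).
    by rewrite ler_pM2l// (le_trans (ler_norm _))// lerDl.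
  by rewrite -ler_pdivlMr// ge_min lexx orbT.
pose l := (t - s + d) / (t - r).
have tr : 0 < t - r by lra.
have lt : l * (t - r) = t - s + d by rewrite divfK// gt_eqF.
have l01 : 0 <= l <= 1.
  by rewrite divr_ge0//= ?ler_pdivrMr//; lra.
have := two_level_mean hg l01 r0 t0 d0.
have -> : l * r + (1 - l) * t + d = s.
  have -> : l * r + (1 - l) * t + d = t - l * (t - r) + d by ring.
  by rewrite lt; ring.
rewrite -(ler_pM2l tr).
have -> : (t - r) * (l * g r + (1 - l) * g t) =
  l * (t - r) * g r + ((t - r) - l * (t - r)) * g t by ring.
by rewrite lt; lra.
Qed.

(** The slopes of a concave increasing function on the interval are bounded by
    a slope that starts at [m / 2]. *)
Lemma mono_concave_lipschitz g (m M : R) : mono_concave g -> 0 < m -> m < M ->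
  lipschitz_itv m M g.
Proof.
move=> [gm gc] m0 mM; have m2 : 0 < m / 2 by rewrite divr_gt0.
have gMm : g (m / 2) <= g M by apply: gm => //; lra.
exists ((g M - g (m / 2)) / (m / 2)); first by rewrite divr_ge0 ?subr_ge0// ltW.
move=> s t; wlog st : s t / s <= t.
  move=> w; case: (leP s t) => [|/ltW] h hs ht; first exact: w.
  by rewrite distrC (distrC s); exact: w.
move=> /andP[ms sM] /andP[mt tM].
move: st; rewrite le_eqVlt => /orP[/eqP->|st]; first by rewrite !subrr normr0 mulr0.
have s0 := lt_le_trans m0 ms.
rewrite distrC (distrC s) !ger0_norm ?subr_ge0 ?(ltW st)//; last by rewrite gm// ltW.
rewrite mulrAC ler_pdivlMr//.
have ms2 : m / 2 < s by lra.
have := gc _ _ _ m2 ms2 st.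
have h1 : g s <= g t by rewrite gm// ltW.
have h2 : g t <= g M by rewrite gm// (lt_trans s0).
move=> h3.
have h4 : (g t - g s) * (m / 2) <= (t - m / 2) * (g t - g s).
  by rewrite mulrC ler_wpM2r ?subr_ge0//; lra.
have h5 : (g t - g (m / 2)) * (t - s) <= (g M - g (m / 2)) * (t - s).
  by rewrite ler_wpM2r ?lerD2r// subr_ge0 ltW.
lra.
Qed.

(** For t > 2 compare the slopes from 1 to t and from 1 to c t; for t <= 2 the
    left-hand side is at most g(2 c). *)
Lemma mono_concave_growth g (c t : R) : mono_concave g -> g 1 = 0 -> 1 < c -> 0 < t ->
  g (c * t) <= 2 * c * `|g t| + g (2 * c).
Proof.
move=> [gm gc] g1 c1 t0.
have g2c : 0 <= g (2 * c) by rewrite -g1 gm//; lra.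
have ct0 : 0 < c * t by rewrite mulr_gt0//; lra.
case: (leP t 2) => t2.
  have h1 : g (c * t) <= g (2 * c) by rewrite gm//; nra.
  by apply: le_trans h1 _; rewrite lerDr mulr_ge0//; lra.
have t1 : 1 < t by lra.
have tct : t < c * t by rewrite ltr_pMl.
have := gc _ _ _ ltr01 t1 tct; rewrite g1 mulr0 add0r => h.
have gt0 : 0 <= g t by rewrite -g1 gm// ltW.
rewrite ger0_norm//.
have h2 : (c * t - 1) * g t <= (t - 1) * (2 * c * g t).
  by rewrite mulrA ler_wpM2r//; nra.
have h3 : g (c * t) <= 2 * c * g t.
  by rewrite -(@ler_pM2l _ (t - 1)) ?subr_gt0//; exact: le_trans h h2.
by apply: le_trans h3 _; rewrite lerDl.
Qed.

End Concavity.

(** * Measurability *)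

Section Measurability.
Variables (R : realType) (H : hilbertType R).
Implicit Types (u v : pdop H) (phi : pdop H -> R).

Definition opnorm_continuous phi := forall u (e : R), 0 < e -> exists2 d : R, 0 < d &
  forall v, opnorm (fun x => v x - u x) < d -> `|phi v - phi u| < e.

Lemma opnorm_continuous_measurable phi : opnorm_continuous phi ->
  measurable_fun setT (phi : borel_pdop H -> R).
Proof.
move=> hphi; apply: (measurability _ (RGenOInfty.measurableE R)) => _ [_ [r ->] <-].
rewrite setTI; apply: sub_sigma_algebra => /=.
suff : pd_open (phi @^-1` `]r, +oo[%classic) by [].
move=> u /=; rewrite in_itv /= andbT => ru.
have pr : 0 < phi u - r by rewrite subr_gt0.
have [d d0 hd] := hphi u _ pr.
exists d => // v /hd; rewrite in_itv /= andbT ltr_norml => /andP[]; lra.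
Qed.

Lemma lipschitz_opnorm_continuous phi (K : R) :
  (forall u v, `|phi v - phi u| <= K * opnorm (fun x => v x - u x)) -> opnorm_continuous phi.
Proof.
move=> h u e e0; have K0 : 0 < `|K| + 1 by rewrite ltr_wpDl.
exists (e / (`|K| + 1)); first exact: divr_gt0.
move=> v; rewrite ltr_pdivlMr// => hv; apply: le_lt_trans (h u v) _.
apply: le_lt_trans hv; rewrite mulrC ler_wpM2l//; last first.
  by rewrite (le_trans (ler_norm _))// lerDl.
have [[bu _ _] [bv _ _]] := (pdopP u, pdopP v).
exact: opnorm_ge0 (bounded_sub bv bu).
Qed.

Lemma mono_concave_opnorm_continuous (f : R -> R) phi : mono_concave f -> (forall u, 0 < phi u) ->
  opnorm_continuous phi -> opnorm_continuous (fun u => f (phi u)).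
Proof.
move=> hf p0 hphi u e e0; have u0 := p0 u.
have u2 : 0 < phi u / 2 by rewrite divr_gt0.
have uu : phi u / 2 < 2 * phi u by lra.
have [L L0 hL] := mono_concave_lipschitz hf u2 uu.
have L1 : 0 < L + 1 by rewrite ltr_wpDl.
have m0 : 0 < Num.min (phi u / 2) (e / (L + 1)) by rewrite lt_min u2 divr_gt0.
have [d d0 hd] := hphi u _ m0; exists d => // v /hd; rewrite lt_min => /andP[h1 h2].
apply: le_lt_trans (hL _ _ _ _) _.
- by move: h1; rewrite ltr_norml => /andP[? ?]; apply/andP; split; lra.
- by apply/andP; split; lra.
apply: (@le_lt_trans _ _ ((L + 1) * `|phi v - phi u|)).
  by rewrite ler_wpM2r// lerDl.
by rewrite mulrC -ltr_pdivlMr.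
Qed.

Lemma opnormD (a b : H -> H) : bounded_op a -> bounded_op b ->
  opnorm (fun x => a x + b x) <= opnorm a + opnorm b.
Proof.
move=> ba bb; apply: opnorm_le; first by rewrite addr_ge0 ?opnorm_ge0.
by move=> x; apply: le_trans (rnormD _ _) _; rewrite mulrDl lerD ?opnorm_ub.
Qed.

Lemma opnorm_dist (a b : H -> H) : bounded_op a -> bounded_op b ->
  `|opnorm a - opnorm b| <= opnorm (fun x => a x - b x).
Proof.
move=> ba bb; have h1 := opnormD (bounded_sub ba bb) bb.
have h2 := opnormD (bounded_sub bb ba) ba.
have E1 : (fun x => a x - b x + b x) = a by apply/funext => x; rewrite subrK.
have E2 : (fun x => b x - a x + a x) = b by apply/funext => x; rewrite subrK.
have E3 : opnorm (fun x => b x - a x) = opnorm (fun x => a x - b x).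
  by rewrite -opnormN; congr opnorm; apply/funext => x; rewrite opprB.
rewrite E1 in h1; rewrite E2 E3 in h2.
by rewrite ler_norml; apply/andP; split; lra.
Qed.

Lemma opnorm_pdop_continuous : opnorm_continuous (fun u => opnorm u).
Proof.
apply: (@lipschitz_opnorm_continuous _ 1) => u v; rewrite mul1r.
by apply: opnorm_dist; [have [] := pdopP v|have [] := pdopP u].
Qed.

Lemma bottom_continuous : opnorm_continuous (fun u => bottom u).
Proof.
apply: (@lipschitz_opnorm_continuous _ 3) => u v.
have [[bu _ _] [bv _ _]] := (pdopP u, pdopP v).
have := opnorm_dist bv bu.
set d := opnorm (fun x => v x - u x) => h1.
pose U x := (opnorm u)%:C *: x - u x; pose V x := (opnorm v)%:C *: x - v x.
have bU : bounded_op U := bounded_sub (bounded_scalar _ _) bu.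
have bV : bounded_op V := bounded_sub (bounded_scalar _ _) bv.
have d0 : 0 <= d by exact: opnorm_ge0 (bounded_sub bv bu).
have h2 : `|opnorm V - opnorm U| <= 2 * d.
  apply: le_trans (opnorm_dist bV bU) _.
  apply: opnorm_le; first by rewrite mulr_ge0.
  move=> x; have -> : V x - U x = (opnorm v - opnorm u)%:C *: x - (v x - u x).
    by rewrite /U /V rmorphB scalerBl !opprB addrACA [RHS]addrACA (addrC (- ((opnorm u)%:C *:
      x))).
  apply: le_trans (rnormD _ _) _; rewrite rnormN rnormZr.
  have := @opnorm_ub _ _ (fun x => v x - u x) x (bounded_sub bv bu).
  have : `|opnorm v - opnorm u| * rnorm x <= d * rnorm x by rewrite ler_wpM2r ?rnorm_ge0.
  rewrite -/d; lra.
rewrite /bottom -/(U) -/(V) -[X in `|X|](_ : (opnorm v - opnorm u) - (opnorm V - opnorm U) =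
  _); last by rewrite /U /V; ring.
apply: le_trans (ler_normB _ _) _; lra.
Qed.

Variable (e : H) (e0 : e != 0).

Lemma bottom_gt0 u : 0 < bottom u.
Proof.
have [m m0 ub] := pdop_op_between u.
by have /andP[+ _] := real_spectrum_between ub (bottom_real_spectrum e0 ub); exact: lt_le_trans.
Qed.

Lemma opnorm_gt0 u : 0 < opnorm u.
Proof.
have [m m0 ub] := pdop_op_between u.
by have /andP[+ _] := real_spectrum_between ub (opnorm_real_spectrum e0 (ltW m0) ub);
  exact: lt_le_trans.
Qed.

Lemma fcalc_pdop (f : R -> R) u : mono_concave f -> is_fcalc f u (fcalc f u).
Proof.
move=> hf; have [m m0 ub] := pdop_op_between u.
apply: (@op_between_fcalc _ _ m (opnorm u + m + 1)).
- have := opnorm_gt0 u; lra.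
- apply: mono_concave_lipschitz => //; have := opnorm_gt0 u; lra.
- by apply: op_between_widen ub => //; lra.
Qed.

(** A monotone function is largest in absolute value at an end of the
    spectrum, and both ends belong to the spectrum. *)
Lemma opnorm_fcalc_extremal (f : R -> R) u : mono_concave f ->
  opnorm (fcalc f u) = Num.max `|f (opnorm u)| `|f (bottom u)|.
Proof.
move=> hf; have [m m0 ub] := pdop_op_between u; have [bu _ _] := ub.
have fu := fcalc_pdop u hf.
apply/eqP; rewrite eq_le; apply/andP; split; last first.
  rewrite ge_max (is_fcalc_ge bu fu (opnorm_real_spectrum e0 (ltW m0) ub)).
  by rewrite (is_fcalc_ge bu fu (bottom_real_spectrum e0 ub)).
apply: (@opnorm_fcalc_le_mono _ _ f (bottom u) (opnorm u)).
- exact: bottom_gt0.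
- by rewrite le_max normr_ge0.
- by case: hf.
- exact: op_between_bottom ub.
- by rewrite lerNl le_max -(normrN (f (bottom u))) ler_norm orbT.
- by rewrite le_max ler_norm.
Qed.

Lemma opnorm_fcalc_measurable (f : R -> R) : mono_concave f ->
  measurable_fun setT (fun u : borel_pdop H => opnorm (fcalc f (u : pdop H))).
Proof.
move=> hf.
rewrite (_ : (fun _ => _) = (fun u : borel_pdop H => `|f (opnorm (u : pdop H))|) \max
   (fun u : borel_pdop H => `|f (bottom (u : pdop H))|)); last first.
  by apply/funext => u; rewrite opnorm_fcalc_extremal.
apply: measurable_maxr; apply: measurableT_comp => //; apply: opnorm_continuous_measurable.
  exact: mono_concave_opnorm_continuous hf opnorm_gt0 opnorm_pdop_continuous.
exact: mono_concave_opnorm_continuous hf bottom_gt0 bottom_continuous.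
Qed.

End Measurability.

(** * Domination over a Thompson ball *)

Lemma thompson_family_le (R : realType) (H : hilbertType R) (f : R ->
  R) (x : pdop H) (e : R) (v : H) :
  v != 0 -> mono_concave f -> mono_concave (fun t => - f t^-1) -> f 1 = 0 ->
  exists c k : R, forall h, thompson_family f x e h ->
    forall y : pdop H, h y <= c * opnorm (fcalc f y) + k.
Proof.
move=> v0 hf hF f1; have [mx mx0 xb] := pdop_op_between x.
pose al := expR (- e) * mx; pose be := expR e * opnorm x.
have al0 : 0 < al by rewrite mulr_gt0 ?expR_gt0.
have be0 : 0 < be by rewrite mulr_gt0 ?expR_gt0 ?(opnorm_gt0 v0).
(* C is at least 1/al and be, the dilations caused by the lower and upper bounds
   of z, and larger than 1 as the growth lemma requires. *)
pose C := 1 + al^-1 + be.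
have C1 : 1 < C by rewrite /C -addrA ltrDl addr_gt0 ?invr_gt0.
have C0 : 0 < C by lra.
have Cal : al^-1 <= C by rewrite /C; have := be0; lra.
have Cbe : be <= C by rewrite /C; have : 0 < al^-1 by [rewrite invr_gt0]; lra.
exists (2 * C), (f (2 * C) - f (2 * C)^-1) => _ [z /= hz <-] y.
have zb : op_between al be z := thompson_between v0 hz mx0 xb.
have [my my0 yb] := pdop_op_between y; have [yby _ _] := yb.
have b0 := bottom_gt0 v0 y; have t0 := opnorm_gt0 v0 y.
have fy := fcalc_pdop v0 y hf.
have cb : op_between (bottom y / C) (C * opnorm y) (invsqrt_congr z y).
  apply: op_between_widen (invsqrt_congr_between al0 zb (ltW b0) be0 (op_between_bottom yb)).
    by rewrite ler_pM2l// lef_pV2.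
  by rewrite mulrC ler_pM2r.
have F1 : - f 1^-1 = 0 by rewrite invr1 f1 oppr0.
have g1 := mono_concave_growth hf f1 C1 t0.
have ib0 : 0 < (bottom y)^-1 by rewrite invr_gt0.
have := mono_concave_growth hF F1 C1 ib0.
rewrite invfM !invrK normrN mulrC => g2.
have h1 := is_fcalc_ge yby fy (opnorm_real_spectrum v0 (ltW my0) yb).
have h2 := is_fcalc_ge yby fy (bottom_real_spectrum v0 yb).
set N := opnorm (fcalc f y) in h1 h2 *.
have C2 : 0 < 2 * C by lra.
have k1 : 2 * C * `|f (opnorm y)| <= 2 * C * N by rewrite ler_pM2l.
have k2 : 2 * C * `|f (bottom y)| <= 2 * C * N by rewrite ler_pM2l.
have f2C : 0 <= f (2 * C) by rewrite -f1; apply hf.1; lra.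
have f2C' : 0 <= - f (2 * C)^-1.
  by rewrite -[leLHS]F1; apply hF.1; lra.
apply: (opnorm_fcalc_le_mono _ _ _ cb).
- exact: divr_gt0.
- have : 0 <= 2 * C * N by apply: le_trans k1; rewrite mulr_ge0// ltW.
  lra.
- by case: hf.
- lra.
- lra.
Qed.

Theorem corollary4p3 (R : realType) (H : hilbertType R)
    (f : R -> R) (f_mono : operator_monotone f) (f1 : f 1 = 0)
    (mu : probability (borel_pdop H) R) (mu_supp : mu (supp mu) = 1%E)
    (f_int : (\int[mu]_y (opnorm (fcalc f (y : pdop H)))%:E < +oo)%E)
    (x : pdop H) (e : R) (e_gt0 : 0 < e) :
  exists g : pdop H -> R,
    mu.-integrable setT (fun y : borel_pdop H => (g y)%:E) /\
    forall h, thompson_family f x e h -> forall y, h y <= g y.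
Proof.
(* On the zero space every norm is 0; otherwise spectra are nonempty. *)
have [[v v0]|trivH] := pselect (exists v : H, v != 0); last first.
  exists (fun=> 0); split; first exact: integrable0.
  move=> _ [z _ <-] y; apply: opnorm_le => // w.
  have -> : rnorm (fcalc f (invsqrt_congr z y) w) = 0; last by rewrite mul0r.
  apply/eqP; rewrite rnorm_eq0; apply: contrapT => /negP w0.
  by apply: trivH; eexists; exact: w0.
have hf : mono_concave f := two_level_mono_concave (operator_monotone_two_level (H := plane R)
  f_mono).
have hF : mono_concave (fun t => - f t^-1) :=
  two_level_mono_concave (two_level_flip (operator_monotone_two_level (H := plane R) f_mono)).
have [c [k hck]] := thompson_family_le x e v0 hf hF f1.
exists (fun y => c * opnorm (fcalc f y) + k); split; last exact: hck.
have fint : mu.-integrable setT (fun y : borel_pdop H => (opnorm (fcalc f (y : pdop H)))%:E).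
  apply/integrableP; split.
    by apply/measurable_EFinP; exact: (opnorm_fcalc_measurable v0 hf).
  rewrite (eq_integral (fun y : borel_pdop H => (opnorm (fcalc f (y : pdop H)))%:E))// => y _.
  rewrite gee0_abs// lee_fin opnorm_ge0//.
  by have [] := fcalc_pdop v0 y hf.
have := integrableD measurableT (integrableZl measurableT c fint)
  (finite_measure_integrable_cst mu k measurableT).
by apply: eq_integrable.
Qed.
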